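(* Let $X$ be an affine $\mathbb{C}$-variety endowed with an action of a complex torus $\mathbb{T}$, let $M=\mathrm{Hom}_{gr}(\mathbb{T},\mathbb{G}_{m,\mathbb{C}})$, and let $d$ be the rank of $M$. Let $\sigma$ be an $\mathbb{R}$-structure on $X$ and let $\tau$ be an $\mathbb{R}$-group structure on $\mathbb{T}$. If the real torus $(\mathbb{T},\tau)$ acts on $(X,\sigma)$, then there exists $n\in\mathbb{N}$, $n\ge d$, such that: (i) there is an $\mathbb{R}$-group structure $\tau'$ on $\mathbb{G}_{m,\mathbb{C}}^n$ that extends to an $\mathbb{R}$-structure $\sigma'$ on $\mathbb{A}^n_{\mathbb{C}}$; (ii) $(\mathbb{T},\tau)$ is a closed subgroup of $(\mathbb{G}_{m,\mathbb{C}}^n,\tau')$; and (iii) $(X,\sigma)$ is a closed subvariety of $(\mathbb{A}^n_{\mathbb{C}},\sigma')$ and $(X,\sigma)\hookrightarrow(\mathbb{A}^n_{\mathbb{C}},\sigma')$ is $(\mathbb{T},\tau)$-equivariant. Moreover, $X$ intersects the dense open orbit of $\mathbb{A}^n_{\mathbb{C}}$ for the natural $\mathbb{G}_{m,\mathbb{C}}^n$-action, and the weight cone of (the $\mathbb{T}$-action on) $\mathbb{A}^n_{\mathbb{C}}$ is the weight cone of $X$.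
   Context: A $\mathbb{C}$-variety is a separated integral scheme of finite type over $\mathbb{C}$. An $\mathbb{R}$-structure on a $\mathbb{C}$-variety $X$ is an involution $\sigma$ of the $\mathbb{R}$-scheme $X$ lying over the automorphism of $\mathrm{Spec}(\mathbb{C})$ induced by complex conjugation. An $\mathbb{R}$-morphism $(X,\sigma)\to(X',\sigma')$ is a morphism of $\mathbb{C}$-varieties $f$ with $\sigma'\circ f=f\circ\sigma$. An $\mathbb{R}$-group structure on a complex algebraic group is an $\mathbb{R}$-structure for which multiplication, inverse and unit are $\mathbb{R}$-morphisms. A real torus $(\mathbb{T},\tau)$ is a complex torus $\mathbb{T}$ with an $\mathbb{R}$-group structure $\tau$. $(\mathbb{T},\tau)$ acts on $(X,\sigma)$ if the $\mathbb{T}$-action $\mu:\mathbb{T}\times X\to X$ satisfies $\sigma\circ\mu=\mu\circ(\tau\times\sigma)$. All torus actions are assumed effective. A $\mathbb{T}$-action on an affine variety $X$ corresponds to a grading $\mathbb{C}[X]=\bigoplus_{m\in M}\mathbb{C}[X]_m$; the weight cone is the cone in $M\otimes\mathbb{Q}$ spanned by $\{m\in M\mid\mathbb{C}[X]_m\ne0\}$. $\mathbb{G}_{m,\mathbb{C}}^n\subset\mathbb{A}^n_{\mathbb{C}}$ is the standard open embedding, and $\mathbb{G}_{m,\mathbb{C}}^n$ acts on $\mathbb{A}^n_{\mathbb{C}}$ coordinatewise (the natural action); $\mathbb{T}$ acts on $\mathbb{A}^n_{\mathbb{C}}$ through the inclusion $\mathbb{T}\hookrightarrow\mathbb{G}_{m,\mathbb{C}}^n$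 of (ii). ''Closed subgroup'' in (ii) means that this inclusion is a closed immersion of algebraic groups which is an $\mathbb{R}$-morphism; ''closed subvariety'' in (iii) means that $X\hookrightarrow\mathbb{A}^n_{\mathbb{C}}$ is a closed immersion that is an $\mathbb{R}$-morphism; it is $(\mathbb{T},\tau)$-equivariant if moreover it is $\mathbb{T}$-equivariant. *)

(* Defs.v *)
From HB Require Import structures.
From mathcomp Require Import all_boot all_order all_algebra.
From mathcomp Require Import boolp classical_sets reals complex.
Set Implicit Arguments.
Unset Strict Implicit.
Unset Printing Implicit Defensive.
Import GRing.Theory Num.Theory.
Local Open Scope ring_scope.
Local Obligation Tactic := idtac.

(* Schemes over C = R[i] are given by their functors of points: an object X is
   a functor S |-> X(S) on commutative rings together with its structural
   morphism X -> Spec C, which sends a point x : Spec S -> X to a ring morphism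
   C -> S, the base of x.  Affine C-varieties are the functors representable by
   a finitely generated C-algebra that is an integral domain.  Keeping the ring
   S free of any fixed C-algebra structure lets antilinear automorphisms (such
   as real structures) act on X(S). *)

Lemma rmorphism_eq (A B : pzRingType) (f g : {rmorphism A -> B}) :
  f =1 g -> f = g.
Proof.
case: f g => f cf [g cg] /= /funext fg; case: _ / fg cg => cg.
congr GRing.RMorphism.Pack.
case: cf cg => [[a] [b]] [[a'] [b']].
by rewrite (Prop_irrelevance a a') (Prop_irrelevance b b').
Qed.

Section Functors.
Context {R : realType}.
Local Notation C := R[i].

Record cfunctor := CFunctor {
  pts : comPzRingType -> Type;
  base : forall S, pts S -> {rmorphism C -> S};
  pull : forall S S' : comPzRingType, {rmorphism S -> S'} -> pts S -> pts S';
  pull_id : forall S (x : pts S), pull idfun x = x;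
  pull_comp : forall (S S' S'' : comPzRingType) (f : {rmorphism S -> S'})
    (g : {rmorphism S' -> S''}) (x : pts S),
    pull (g \o f) x = pull g (pull f x);
  base_pull : forall (S S' : comPzRingType) (f : {rmorphism S -> S'})
    (x : pts S), base (pull f x) = f \o base x :> {rmorphism C -> S'}
}.

Record mor (X Y : cfunctor) := Mor {
  mor_fun :> forall S, pts X S -> pts Y S;
  mor_pull : forall (S S' : comPzRingType) (f : {rmorphism S -> S'})
    (x : pts X S), mor_fun (pull f x) = pull f (mor_fun x);
  mor_base : forall S (x : pts X S), base (mor_fun x) = base x
}.

(* An involution of the functor lying over complex conjugation on Spec C. *)
Record real_structure (X : cfunctor) := RealStructure {
  rs_fun :> forall S, pts X S -> pts X S;
  rs_pull : forall (S S' : comPzRingType) (f : {rmorphism S -> S'})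
    (x : pts X S), rs_fun (pull f x) = pull f (rs_fun x);
  rs_base : forall S (x : pts X S),
    base (rs_fun x) = base x \o @conjc R :> {rmorphism C -> S};
  rs_inv : forall S (x : pts X S), rs_fun (rs_fun x) = x
}.

Definition real_mor (X Y : cfunctor) (s : real_structure X)
    (s' : real_structure Y) (f : mor X Y) : Prop :=
  forall S (x : pts X S), s' S (f S x) = f S (s S x).

Section Product.
Variables X Y : cfunctor.

Definition prod_pts (S : comPzRingType) : Type :=
  {p : pts X S * pts Y S | base p.1 = base p.2}.

Definition pt_pair S (x : pts X S) (y : pts Y S) (h : base x = base y) :
  prod_pts S := exist _ (x, y) h.

Lemma prod_pts_eq S (p q : prod_pts S) :
  (sval p).1 = (sval q).1 -> (sval p).2 = (sval q).2 -> p = q.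
Proof.
case: p q => [[x y] h] [[x' y'] h'] /= e1 e2; subst x' y'.
by rewrite (Prop_irrelevance h h').
Qed.

Lemma prod_pull_subproof (S S' : comPzRingType) (f : {rmorphism S -> S'})
  (p : prod_pts S) : base (pull f (sval p).1) = base (pull f (sval p).2).
Proof. by case: p => [[x y] /= h]; rewrite !base_pull h. Qed.

Program Definition cprod : cfunctor := {|
  pts := prod_pts;
  base S p := base (sval p).1;
  pull S S' f p := pt_pair (prod_pull_subproof f p) |}.
Next Obligation. by move=> S x; apply: prod_pts_eq; rewrite /= pull_id. Qed.
Next Obligation.
by move=> S S' S'' f g x; apply: prod_pts_eq; rewrite /= pull_comp.
Qed.
Next Obligation. by move=> S S' f x /=; rewrite base_pull. Qed.

Lemma rs_prod_subproof (s : real_structure X) (s' : real_structure Y) S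
  (p : prod_pts S) : base (s S (sval p).1) = base (s' S (sval p).2).
Proof. by case: p => [[x y] /= h]; rewrite !rs_base h. Qed.

Program Definition rs_prod (s : real_structure X) (s' : real_structure Y) :
  real_structure cprod := {|
  rs_fun S p := pt_pair (rs_prod_subproof s s' p) |}.
Next Obligation.
by move=> s s' S S' f x; apply: prod_pts_eq; rewrite /= rs_pull.
Qed.
Next Obligation. by move=> s s' S x /=; rewrite rs_base. Qed.
Next Obligation. by move=> s s' S x; apply: prod_pts_eq; rewrite /= rs_inv. Qed.

End Product.

Section Spec.
Variable A : comAlgType C.

Program Definition spec : cfunctor := {|
  pts := fun S : comPzRingType => {rmorphism A -> S};
  base S x := x \o in_alg A : {rmorphism C -> S};
  pull S S' f x := f \o x : {rmorphism A -> S'} |}.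
Next Obligation. by move=> S x; apply: rmorphism_eq. Qed.
Next Obligation. by move=> S S' S'' f g x; apply: rmorphism_eq. Qed.
Next Obligation. by move=> S S' f x; apply: rmorphism_eq. Qed.

End Spec.

Definition isomorphic (X Y : cfunctor) : Prop :=
  exists (f : mor X Y) (g : mor Y X),
    (forall S x, g S (f S x) = x) /\ (forall S y, f S (g S y) = y).

Definition integral (A : comAlgType C) : Prop :=
  forall a b : A, a * b = 0 -> a = 0 \/ b = 0.

Definition finitely_generated (A : comAlgType C) : Prop :=
  exists s : seq A, forall P : {pred A},
    GRing.subalg_closed P -> {subset s <= P} -> forall a, a \in P.

(* A comAlgType is nontrivial, so [integral A] says that A is a domain. *)
Definition affine_variety (X : cfunctor) : Prop :=
  exists A : comAlgType C,
    [/\ integral A, finitely_generated A & isomorphic X (spec A)].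

(* Regular functions are the morphisms to the affine line over Z; for X = spec A
   they are the elements of A, by the Yoneda lemma. *)
Record regfun (X : cfunctor) := RegFun {
  rf_fun :> forall S, pts X S -> S;
  rf_pull : forall (S S' : comPzRingType) (f : {rmorphism S -> S'})
    (x : pts X S), rf_fun (pull f x) = f (rf_fun x)
}.

(* The ring morphism C[Y] -> C[X] is surjective; this is the usual notion when
   X and Y are affine. *)
Definition closed_immersion (X Y : cfunctor) (f : mor X Y) : Prop :=
  forall g : regfun X, exists h : regfun Y,
    forall S (x : pts X S), g S x = h S (f S x).

Definition complex_point (X : cfunctor) (x : pts X C) : Prop := base x =1 id.

Definition zariski_open (X : cfunctor) (U : set (pts X C)) : Prop :=
  forall x, complex_point x -> U x ->
    exists f : regfun X, f C x <> 0 /\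
      forall y, complex_point y -> f C y <> 0 -> U y.

Definition zariski_dense (X : cfunctor) (U : set (pts X C)) : Prop :=
  forall V : set (pts X C), zariski_open V ->
    (exists x, complex_point x /\ V x) ->
    exists x, [/\ complex_point x, V x & U x].

Program Definition spec_C : cfunctor := {|
  pts := fun S : comPzRingType => {rmorphism C -> S};
  base S x := x;
  pull S S' f x := f \o x : {rmorphism C -> S'} |}.
Next Obligation. by move=> S x; apply: rmorphism_eq. Qed.
Next Obligation. by move=> S S' S'' f g x; apply: rmorphism_eq. Qed.
Next Obligation. by []. Qed.

Program Definition rs_C : real_structure spec_C := {|
  rs_fun S x := x \o @conjc R : {rmorphism C -> S} |}.
Next Obligation. by move=> S S' f x; apply: rmorphism_eq. Qed.
Next Obligation. by []. Qed.
Next Obligation.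
by move=> S x; apply: rmorphism_eq => a /=; rewrite conjcK.
Qed.

Record cgroup := CGroup {
  gfun :> cfunctor;
  gmul : mor (cprod gfun gfun) gfun;
  gunit : mor spec_C gfun;
  ginv : mor gfun gfun;
  gmulA : forall S (x y z : pts gfun S) (hxy : base x = base y)
    (hyz : base y = base z)
    (h : base x = base (gmul S (pt_pair hyz)))
    (h' : base (gmul S (pt_pair hxy)) = base z),
    gmul S (pt_pair h) = gmul S (pt_pair h');
  gmul1 : forall S (x : pts gfun S) (h : base (gunit S (base x)) = base x),
    gmul S (pt_pair h) = x;
  gmulV : forall S (x : pts gfun S) (h : base (ginv S x) = base x),
    gmul S (pt_pair h) = gunit S (base x)
}.

Record ghom (G H : cgroup) := GHom {
  ghom_mor :> mor G H;
  ghomM : forall S (x y : pts G S) (h : base x = base y)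
    (h' : base (ghom_mor S x) = base (ghom_mor S y)),
    ghom_mor S (gmul G S (pt_pair h)) = gmul H S (pt_pair h')
}.

Definition real_group_structure (G : cgroup) (t : real_structure G) : Prop :=
  [/\ real_mor (rs_prod t t) t (gmul G), real_mor rs_C t (gunit G)
    & real_mor t t (ginv G)].

Record gaction (G : cgroup) (X : cfunctor) := GAction {
  act :> mor (cprod G X) X;
  actM : forall S (g g' : pts G S) (x : pts X S) (hg : base g = base g')
    (hx : base g' = base x)
    (h : base (gmul G S (pt_pair hg)) = base x)
    (h' : base g = base (act S (pt_pair hx))),
    act S (pt_pair h) = act S (pt_pair h');
  act1 : forall S (x : pts X S) (h : base (gunit G S (base x)) = base x),
    act S (pt_pair h) = x
}.

Definition real_action (G : cgroup) (X : cfunctor) (t : real_structure G)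
    (s : real_structure X) (mu : gaction G X) : Prop :=
  real_mor (rs_prod t s) s mu.

(* The only complex point of G that acts as the identity morphism of X is 1. *)
Definition effective (G : cgroup) (X : cfunctor) (mu : gaction G X) : Prop :=
  forall g : pts G C, complex_point g ->
    (forall S (x : pts X S) (h : base (pull (base x) g) = base x),
       mu S (pt_pair h) = x) ->
    g = gunit G C (base g).

Definition gorbit (G : cgroup) (X : cfunctor) (mu : gaction G X)
    (x : pts X C) : set (pts X C) :=
  [set y | exists (g : pts G C) (h : base g = base x), y = mu C (pt_pair h)].

Definition equivariant (G : cgroup) (X Y : cfunctor) (mu : gaction G X)
    (nu : gaction G Y) (f : mor X Y) : Prop :=
  forall S (g : pts G S) (x : pts X S) (h : base g = base x)
    (h' : base g = base (f S x)),
    f S (mu S (pt_pair h)) = nu S (pt_pair h').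

Section Restriction.
Variables (G H : cgroup) (X : cfunctor) (j : ghom G H) (nu : gaction H X).

Lemma restr_subproof S (p : prod_pts G X S) :
  base (j S (sval p).1) = base (sval p).2.
Proof. by case: p => [[g x] /= h]; rewrite mor_base. Qed.

Program Definition restr_mor : mor (cprod G X) X := {|
  mor_fun S p := nu S (pt_pair (restr_subproof p)) |}.
Next Obligation.
move=> S S' f x; rewrite -mor_pull; congr (nu _ _).
by apply: prod_pts_eq; rewrite /= ?mor_pull.
Qed.
Next Obligation. by move=> S x; rewrite mor_base /= mor_base. Qed.

End Restriction.

Lemma gunit_eq (G : cgroup) S (g : pts G S) (h : base g = base g) :
  gmul G S (pt_pair h) = g -> g = gunit G S (base g).
Proof.
move=> gg; have hi : base (ginv G S g) = base g by rewrite mor_base.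
have hi' : base (ginv G S g) = base (gmul G S (pt_pair h)) by rewrite gg.
have h1 : base (gmul G S (pt_pair hi)) = base g by rewrite mor_base /= hi.
have hu : base (gunit G S (base g)) = base g by rewrite mor_base.
have e1 : pt_pair hi' = pt_pair hi by apply: prod_pts_eq; rewrite /= ?gg.
have e2 : pt_pair h1 = pt_pair hu by apply: prod_pts_eq; rewrite /= ?gmulV.
by have := gmulA hi' h1; rewrite e1 e2 gmul1 gmulV => ->.
Qed.

Lemma ghom1 (G H : cgroup) (j : ghom G H) (S : comPzRingType) (c : {rmorphism C -> S}) :
  j S (gunit G S c) = gunit H S c.
Proof.
set e := gunit G S c.
have be : base e = c by rewrite mor_base.
have h : base (gunit G S (base e)) = base e by rewrite be.
have h' : base (j S e) = base (j S e) by [].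
have h0 : base e = base e by [].
have -> : gunit H S c = gunit H S (base (j S e)) by rewrite mor_base be.
apply: (gunit_eq (h := h')).
rewrite -(ghomM h0) (_ : pt_pair h0 = pt_pair h); first by rewrite gmul1.
by apply: prod_pts_eq; rewrite /= ?be.
Qed.

Program Definition restr_action (G H : cgroup) (X : cfunctor) (j : ghom G H)
  (nu : gaction H X) : gaction G X := {| act := restr_mor j nu |}.
Next Obligation.
move=> G H X j nu S g g' x hg hx h h' /=.
have hg2 : base (j S g) = base (j S g') by rewrite !mor_base.
have hx2 : base (j S g') = base x by rewrite mor_base.
have h2 : base (gmul H S (pt_pair hg2)) = base x.
  by rewrite mor_base /= mor_base hg.
have h2' : base (j S g) = base (nu S (pt_pair hx2)).
  by rewrite [RHS]mor_base /= hg2.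
transitivity (nu S (pt_pair h2)).
  by congr (nu _ _); apply: prod_pts_eq => //=; apply: ghomM.
rewrite (actM h2 h2'); congr (nu _ _); apply: prod_pts_eq => //=.
by congr (nu _ _); apply: prod_pts_eq.
Qed.
Next Obligation.
move=> G H X j nu S x h /=.
have h1 : base (gunit H S (base x)) = base x by rewrite mor_base.
rewrite -[RHS](act1 nu h1); congr (nu _ _); apply: prod_pts_eq => //=.
exact: ghom1.
Qed.

Section Standard.
Variable n : nat.

Program Definition affine_space : cfunctor := {|
  pts := fun S : comPzRingType => ({rmorphism C -> S} * ('I_n -> S))%type;
  base S x := x.1;
  pull S S' f x := (f \o x.1 : {rmorphism C -> S'}, f \o x.2) |}.
Next Obligation. by move=> S [c v]; congr pair; apply: rmorphism_eq. Qed.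
Next Obligation.
by move=> S S' S'' f g [c v]; congr pair; apply: rmorphism_eq.
Qed.
Next Obligation. by []. Qed.

(* A point of the torus is a family u of units of S, given with the family v of
   their inverses. *)
Definition Gm_pts (S : comPzRingType) : Type :=
  ({rmorphism C -> S} *
   {p : ('I_n -> S) * ('I_n -> S) | forall i, (p.1 i * p.2 i = 1)%R})%type.

Definition Gm_val S (x : Gm_pts S) : 'I_n -> S := (sval x.2).1.

Lemma Gm_pts_eq S (x y : Gm_pts S) :
  x.1 = y.1 -> Gm_val x = Gm_val y -> x = y.
Proof.
rewrite /Gm_val.
case: x y => [c [[u v] h]] [c' [[u' v'] h']] /= e1 e2; subst c' u'.
have e : v = v'.
  apply/funext => i; have := h i; have := h' i; rewrite /= => h1 h2.
  by rewrite -[LHS]mul1r -h1 mulrAC h2 mul1r.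
by subst v'; rewrite (Prop_irrelevance h h').
Qed.

Lemma Gm_pull_subproof (S S' : comPzRingType) (f : {rmorphism S -> S'})
  (x : Gm_pts S) i :
  (f \o (sval x.2).1, f \o (sval x.2).2).1 i *
  (f \o (sval x.2).1, f \o (sval x.2).2).2 i = 1.
Proof. by case: x => [c [[u v] h]] /=; rewrite -rmorphM h rmorph1. Qed.

Program Definition Gm_functor : cfunctor := {|
  pts := Gm_pts;
  base S x := x.1;
  pull S S' f x := (f \o x.1 : {rmorphism C -> S'},
                    exist _ _ (Gm_pull_subproof f x)) |}.
Next Obligation.
by move=> S x; apply: Gm_pts_eq => //; apply: rmorphism_eq.
Qed.
Next Obligation.
by move=> S S' S'' f g x; apply: Gm_pts_eq => //; apply: rmorphism_eq.
Qed.
Next Obligation. by []. Qed.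

Lemma Gm_mul_subproof S (x y : Gm_pts S) i :
  (fun k => (sval x.2).1 k * (sval y.2).1 k,
   fun k => (sval x.2).2 k * (sval y.2).2 k).1 i *
  (fun k => (sval x.2).1 k * (sval y.2).1 k,
   fun k => (sval x.2).2 k * (sval y.2).2 k).2 i = 1.
Proof.
by case: x y => [c [[u v] h]] [c' [[u' v'] h']] /=; rewrite mulrACA h h' mulr1.
Qed.

Lemma Gm_inv_subproof S (x : Gm_pts S) i :
  ((sval x.2).2, (sval x.2).1).1 i * ((sval x.2).2, (sval x.2).1).2 i = 1.
Proof. by case: x => [c [[u v] h]] /=; rewrite mulrC h. Qed.

Program Definition Gm_mul : mor (cprod Gm_functor Gm_functor) Gm_functor := {|
  mor_fun S p := ((sval p).1.1,
                  exist _ _ (Gm_mul_subproof (sval p).1 (sval p).2)) |}.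
Next Obligation.
move=> S S' f x; apply: Gm_pts_eq => //.
by apply/funext => i; rewrite /Gm_val /= rmorphM.
Qed.
Next Obligation. by []. Qed.

Lemma Gm_one_subproof (S : comPzRingType) (i : 'I_n) :
  ((fun=> 1, fun=> 1) : ('I_n -> S) * ('I_n -> S)).1 i *
  ((fun=> 1, fun=> 1) : ('I_n -> S) * ('I_n -> S)).2 i = 1.
Proof. by rewrite /= mulr1. Qed.

Program Definition Gm_unit : mor spec_C Gm_functor := {|
  mor_fun S c := (c, exist _ _ (@Gm_one_subproof S)) |}.
Next Obligation.
move=> S S' f x; apply: Gm_pts_eq => //.
by apply/funext => i; rewrite /Gm_val /= rmorph1.
Qed.
Next Obligation. by []. Qed.

Program Definition Gm_inv : mor Gm_functor Gm_functor := {|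
  mor_fun S x := (x.1, exist _ _ (Gm_inv_subproof x)) |}.
Next Obligation. by move=> S S' f x; apply: Gm_pts_eq. Qed.
Next Obligation. by []. Qed.

Program Definition Gm : cgroup := {|
  gfun := Gm_functor; gmul := Gm_mul; gunit := Gm_unit; ginv := Gm_inv |}.
Next Obligation.
move=> S x y z hxy hyz h h'; apply: Gm_pts_eq => //.
by apply/funext => i; rewrite /Gm_val /= mulrA.
Qed.
Next Obligation.
move=> S x h; apply: Gm_pts_eq => //.
by apply/funext => i; rewrite /Gm_val /= mul1r.
Qed.
Next Obligation.
move=> S [c [[u v] e]] h; apply: Gm_pts_eq => //.
by apply/funext => i; rewrite /Gm_val /= mulrC e.
Qed.

Program Definition std_embedding : mor Gm affine_space := {|
  mor_fun S x := (x.1, Gm_val x) |}.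
Next Obligation. by []. Qed.
Next Obligation. by []. Qed.

Program Definition natural_mor : mor (cprod Gm affine_space) affine_space := {|
  mor_fun S p := ((sval p).2.1,
                  fun i => Gm_val (sval p).1 i * (sval p).2.2 i) |}.
Next Obligation.
move=> S S' f x /=; congr pair; apply/funext => i.
by rewrite /Gm_val /= rmorphM.
Qed.
Next Obligation. by move=> S [[x y] /= h]. Qed.

Program Definition natural_action : gaction Gm affine_space := {|
  act := natural_mor |}.
Next Obligation.
move=> S g g' x hg hx h h' /=; congr pair; apply/funext => i.
by rewrite /Gm_val /= mulrA.
Qed.
Next Obligation.
move=> S [c v] h /=; congr pair; apply/funext => i.
by rewrite /Gm_val /= mul1r.
Qed.

End Standard.

Definition torus (T : cgroup) : Prop :=
  exists (r : nat) (f : ghom T (Gm r)) (g : ghom (Gm r) T),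
    (forall S x, g S (f S x) = x) /\ (forall S y, f S (g S y) = y).

Section Character.
Variable G : cgroup.

Definition character : Type := ghom G (Gm 1).

Definition char_val (m : character) S (g : pts G S) : S := Gm_val (m S g) ord0.

Definition char_pow (m : character) (k : int) S (g : pts G S) : S :=
  match k with
  | Posz j => char_val m g ^+ j
  | Negz j => Gm_val (Gm_inv 1 S (m S g)) ord0 ^+ j.+1
  end.

(* The group law of the character group M is the multiplication of values, so
   this says that m is the combination of the e_i with coefficients z_i. *)
Definition char_coord d (e : 'I_d -> character) (m : character)
    (z : 'rV[int]_d) : Prop :=
  forall S (g : pts G S), char_val m g = \prod_i char_pow (e i) (z 0 i) g.

(* The existence of e says that M is free of rank d. *)
Definition lattice_basis d (e : 'I_d -> character) : Prop :=
  forall m : character, exists! z : 'rV[int]_d, char_coord e m z.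

End Character.

(* f belongs to C[X]_m, with the convention f (t . x) = m(t) f(x). *)
Definition homogeneous (G : cgroup) (X : cfunctor) (mu : gaction G X)
    (m : character G) (f : regfun X) : Prop :=
  forall S (g : pts G S) (x : pts X S) (h : base g = base x),
    f S (mu S (pt_pair h)) = char_val m g * f S x.

Definition weight (G : cgroup) (X : cfunctor) (mu : gaction G X)
    (m : character G) : Prop :=
  exists f : regfun X, homogeneous mu m f /\ exists S (x : pts X S), f S x <> 0.

Definition cone d (W : set 'rV[rat]_d) : set 'rV[rat]_d :=
  [set v | exists (k : nat) (q : 'I_k -> rat) (w : 'I_k -> 'rV[rat]_d),
     [/\ forall i, 0 <= q i, forall i, W (w i) & v = \sum_i q i *: w i]].

(* A basis e of the character group M identifies M (x) Q with Q^d. *)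
Definition weight_cone (G : cgroup) (X : cfunctor) (mu : gaction G X) d
    (e : 'I_d -> character G) : set 'rV[rat]_d :=
  cone [set v | exists (m : character G) (z : 'rV[int]_d),
    [/\ weight mu m, char_coord e m z & v = map_mx intr z]].

End Functors.

Arguments cfunctor R : clear implicits.
Arguments cgroup R : clear implicits.
Arguments spec_C R : clear implicits.
Arguments affine_space R n : clear implicits.
Arguments Gm R n : clear implicits.
Arguments std_embedding R n : clear implicits.
Arguments natural_action R n : clear implicits.

(* Main.v *)
From HB Require Import structures.
Require Import Defs.
From mathcomp Require Import all_boot all_order all_algebra.
From mathcomp Require Import ring.
From mathcomp Require Import boolp classical_sets reals complex.
Set Implicit Arguments.
Unset Strict Implicit.
Unset Printing Implicit Defensive.
Import GRing.Theory Num.Theory.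
Local Open Scope ring_scope.
Local Obligation Tactic := idtac.

(** The embedding is given by semi-invariant functions on X.  A torus action
    splits C[X] into weight spaces, so C[X] is generated by finitely many
    nonzero homogeneous functions f_1, ..., f_k.  Composition with sigma sends
    a function of weight m to one of weight m o tau, so the family
    f_1, ..., f_k, f_1 o sigma, ..., f_k o sigma is again homogeneous, and it is
    permuted by sigma through the exchange of its two halves.  With n = 2k,
    this family embeds X in the affine space A^n, its weights map T to G_m^n,
    and the real structures on A^n and on G_m^n are complex conjugation of
    scalars combined with the exchange of coordinates.  Adding d copies of the
    constant function 1 before doubling gives n >= d.  All the compatibilities
    are then formal; five facts need an argument.

    - Weight spaces ([homogeneous_decomposition]).  A regular function on
      T x Y is a finite sum of Laurent monomials on T times functions on Y
      ([laurent_expansion]).  Expanding f(t y) in this way, the coefficients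
      are homogeneous because characters are linearly independent
      ([character_independence]).  The expansion rests on [regfun_term]: a
      functor that is cut out by polynomial identities in some coordinates has
      only polynomial expressions as regular functions, by evaluation at the
      generic point.

    - T -> G_m^n is a closed immersion ([tuple_closed_immersion]).  By the
      Smith normal form, either the weights of the f_i generate the character
      lattice of T, and every character is a monomial in them, or some
      complex point t <> 1 of T is killed by all of them
      ([lattice_dichotomy]).  In the second case t fixes every f_i, hence acts
      trivially on X, against effectiveness ([effective_generates]).

    - X meets the open orbit.  The product of the n functions is nonzero since
      C[X] is a domain, so it does not vanish at some complex point; this is
      the [nullstellensatz].

    - The orbit of (1, ..., 1) is dense ([orbit_dense]): on a line joining a
      point of an open set to (1, ..., 1), the two open conditions are
      nonvanishing conditions on nonzero polynomials in one variable.

    - A^n and X even have the same weights ([weight_affine]).  A function on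
      A^n is a sum of monomials, and both on A^n and on X a nonzero
      homogeneous function that is a sum of homogeneous ones has the weight of
      one of them ([weight_of_sum]); so in both cases the weights are the
      products of the weights of the coordinates, monomials in the f_i being
      nonzero on X. *)

(** * Regular functions are polynomials in coordinates *)

(** Polynomial expressions before any identification; evaluation makes sense in
    every commutative ring, the zero ring included. *)
Inductive term (K I : Type) :=
  | Cst of K
  | Var of I
  | Add of term K I & term K I
  | Mul of term K I & term K I.
Arguments Cst {K I}.
Arguments Var {K I}.
Arguments Add {K I}.
Arguments Mul {K I}.

HB.instance Definition _ (K I : Type) := gen_eqMixin (term K I).
HB.instance Definition _ (K I : Type) := gen_choiceMixin (term K I).

Fixpoint teval (K : pzRingType) (I : Type) (S : comPzRingType)
    (b : {rmorphism K -> S}) (v : I -> S) (t : term K I) : S :=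
  match t with
  | Cst c => b c
  | Var i => v i
  | Add s t => teval b v s + teval b v t
  | Mul s t => teval b v s * teval b v t
  end.

Section Coordinates.
Context {R : realType}.
Local Notation C := R[i].

Lemma teval_morph (I : Type) (S S' : comPzRingType) (f : {rmorphism S -> S'})
    (b : {rmorphism C -> S}) (b' : {rmorphism C -> S'}) (v : I -> S) (t : term C I) :
  b' =1 f \o b -> f (teval b v t) = teval b' (f \o v) t.
Proof.
move=> e; elim: t => //= s IHs t IHt.
- by rewrite rmorphD IHs IHt.
- by rewrite rmorphM IHs IHt.
Qed.

Section Family.
Variables (Y : cfunctor R) (I : Type) (x : I -> regfun Y).

Definition tval S (y : pts Y S) (t : term C I) : S :=
  teval (base y) (fun i => x i S y) t.

Definition law_abiding (S : comPzRingType) (b : {rmorphism C -> S}) (v : I -> S) : Prop :=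
  forall s t : term C I,
    (forall S' (y : pts Y S'), tval y s = tval y t) -> teval b v s = teval b v t.

(** In these terms, Y is an affine scheme, closed in the affine space with one
    axis for each element of I: a family of scalars is a point of Y as soon as
    it obeys the polynomial identities that hold on all of Y. *)
Definition coordinates : Prop :=
  (forall S (y y' : pts Y S),
     base y = base y' -> (forall i, x i S y = x i S y') -> y = y') /\
  (forall (S : comPzRingType) (b : {rmorphism C -> S}) (v : I -> S), law_abiding b v ->
     exists y : pts Y S, base y = b /\ forall i, x i S y = v i).

(** The coordinate ring of Y is built as terms modulo equality at all points,
    so that its ring axioms hold because they hold in every ring of values. *)
Definition term_eqv (s t : term C I) : bool :=
  `[< forall S (y : pts Y S), tval y s = tval y t >].

Lemma term_eqv_is_equiv : equiv_class_of term_eqv.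
Proof.
split=> [s|s t|s t u]; first by apply/asboolP.
  by apply/asboolP/asboolP => h S y; rewrite h.
by move=> /asboolP h1 /asboolP h2; apply/asboolP => S y; rewrite h1.
Qed.

Canonical term_equiv := EquivRelPack term_eqv_is_equiv.

Definition funring := {eq_quot term_eqv}%qT.
HB.instance Definition _ := Choice.on funring.
HB.instance Definition _ := EqQuotient.on funring.

Definition fval S (y : pts Y S) (q : funring) : S := tval y (repr q).

Lemma fval_pi S (y : pts Y S) t : fval y (\pi_funring t)%qT = tval y t.
Proof.
have : (\pi_funring (repr (\pi_funring t)) = \pi_funring t)%qT by rewrite reprK.
by move/eqmodP/asboolP => /(_ S y).
Qed.

Lemma funring_eq (p q : funring) :
  (forall S (y : pts Y S), fval y p = fval y q) -> p = q.
Proof.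
by move=> h; rewrite -[p]reprK -[q]reprK; apply/eqmodP/asboolP.
Qed.

Definition fq0 : funring := (\pi_funring (Cst 0))%qT.
Definition fq1 : funring := (\pi_funring (Cst 1))%qT.
Definition fqadd (p q : funring) : funring := (\pi_funring (Add (repr p) (repr q)))%qT.
Definition fqmul (p q : funring) : funring := (\pi_funring (Mul (repr p) (repr q)))%qT.
Definition fqopp (p : funring) : funring := (\pi_funring (Mul (Cst (-1)) (repr p)))%qT.

Lemma fval0 S (y : pts Y S) : fval y fq0 = 0.
Proof. by rewrite fval_pi /tval /= rmorph0. Qed.
Lemma fval1 S (y : pts Y S) : fval y fq1 = 1.
Proof. by rewrite fval_pi /tval /= rmorph1. Qed.
Lemma fvalD S (y : pts Y S) p q : fval y (fqadd p q) = fval y p + fval y q.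
Proof. by rewrite fval_pi. Qed.
Lemma fvalM S (y : pts Y S) p q : fval y (fqmul p q) = fval y p * fval y q.
Proof. by rewrite fval_pi. Qed.
Lemma fvalN S (y : pts Y S) p : fval y (fqopp p) = - fval y p.
Proof. by rewrite fval_pi /tval /= rmorphN1 mulN1r. Qed.

Let fvalE := (fval0, fval1, fvalD, fvalM, fvalN).

Fact fqaddA : associative fqadd.
Proof. by move=> p q r; apply: funring_eq => S y; rewrite !fvalE addrA. Qed.
Fact fqaddC : commutative fqadd.
Proof. by move=> p q; apply: funring_eq => S y; rewrite !fvalE addrC. Qed.
Fact fqadd0 : left_id fq0 fqadd.
Proof. by move=> p; apply: funring_eq => S y; rewrite !fvalE add0r. Qed.
Fact fqaddN : left_inverse fq0 fqopp fqadd.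
Proof. by move=> p; apply: funring_eq => S y; rewrite !fvalE addNr. Qed.
Fact fqmulA : associative fqmul.
Proof. by move=> p q r; apply: funring_eq => S y; rewrite !fvalE mulrA. Qed.
Fact fqmulC : commutative fqmul.
Proof. by move=> p q; apply: funring_eq => S y; rewrite !fvalE mulrC. Qed.
Fact fqmul1 : left_id fq1 fqmul.
Proof. by move=> p; apply: funring_eq => S y; rewrite !fvalE mul1r. Qed.
Fact fqmulD : left_distributive fqmul fqadd.
Proof. by move=> p q r; apply: funring_eq => S y; rewrite !fvalE mulrDl. Qed.

HB.instance Definition _ :=
  GRing.isZmodule.Build funring fqaddA fqaddC fqadd0 fqaddN.
HB.instance Definition _ :=
  GRing.Zmodule_isComPzRing.Build funring fqmulA fqmulC fqmul1 fqmulD.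

Fact fval_zmod S (y : pts Y S) : zmod_morphism (fval y).
Proof. by move=> p q; rewrite fvalD fvalN. Qed.
Fact fval_monoid S (y : pts Y S) : monoid_morphism (fval y).
Proof. by split=> [|p q]; rewrite ?fval1 ?fvalM. Qed.
HB.instance Definition _ S (y : pts Y S) :=
  GRing.isZmodMorphism.Build funring S (fval y) (fval_zmod y).
HB.instance Definition _ S (y : pts Y S) :=
  GRing.isMonoidMorphism.Build funring S (fval y) (fval_monoid y).

Definition funring_base (c : C) : funring := (\pi_funring (Cst c))%qT.

Lemma fval_base S (y : pts Y S) c : fval y (funring_base c) = base y c.
Proof. by rewrite fval_pi. Qed.

Fact funring_base_zmod : zmod_morphism funring_base.
Proof.
by move=> a b; apply: funring_eq => S y; rewrite [RHS]rmorphB /= !fval_base rmorphB.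
Qed.
Fact funring_base_monoid : monoid_morphism funring_base.
Proof.
split=> [|a b]; apply: funring_eq => S y.
  by rewrite [RHS]rmorph1 fval_base rmorph1.
by rewrite [RHS]rmorphM /= !fval_base rmorphM.
Qed.
HB.instance Definition _ :=
  GRing.isZmodMorphism.Build C funring funring_base funring_base_zmod.
HB.instance Definition _ :=
  GRing.isMonoidMorphism.Build C funring funring_base funring_base_monoid.

Lemma teval_funring t :
  teval funring_base (fun i => \pi_funring (Var i))%qT t = (\pi_funring t)%qT.
Proof.
apply: funring_eq => S y; rewrite fval_pi (teval_morph (b' := base y)); last first.
  by move=> c; rewrite /= fval_base.
by congr teval; apply/funext => i; rewrite /= fval_pi.
Qed.

(** The classes of the variables satisfy all identities between coordinates, so
    they are the coordinates of a point of Y with values in [funring], the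
    generic point.  Every other point is its image under [fval], and a function
    is determined by its value at the generic point, which is the class of a
    term. *)
Theorem regfun_term : coordinates -> forall F : regfun Y,
  exists t, forall S (y : pts Y S), F S y = tval y t.
Proof.
case=> inj surj F.
have [|y0 [y0b y0v]] := surj funring funring_base (fun i => \pi_funring (Var i))%qT.
  move=> s t st; rewrite !teval_funring; apply: funring_eq => S y.
  by rewrite !fval_pi.
exists (repr (F _ y0)) => S y.
have e : pull (fval y) y0 = y.
  apply: inj => [|i].
    by rewrite base_pull y0b; apply: rmorphism_eq => c /=; rewrite fval_base.
  by rewrite rf_pull y0v /= fval_pi.
by rewrite -{1}e rf_pull.
Qed.

End Family.
End Coordinates.

(** * The Nullstellensatz *)
Lemma exists_minimizer (T : Type) (P : T -> Prop) (w : T -> nat) :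
  (exists x, P x) -> exists2 x, P x & forall y, P y -> (w x <= w y)%N.
Proof.
case=> x; have [n] := ubnP (w x); elim: n x => // n IHn x wx Px.
have [[y [Py wy]]|no] := pselect (exists y, P y /\ (w y < w x)%N).
  by apply: (IHn y) => //; apply: leq_trans wy _.
by exists x => // y Py; rewrite leqNgt; apply/negP => wy; apply: no; exists y.
Qed.

Section Nullstellensatz.
Variable K : closedFieldType.

(** The condition on the ring P, seen as a ring of polynomials, is that every
    f that is nonzero on an integral quotient of P is nonzero at some K-point
    of that quotient.  Quantifying over all maps to domains rather than over
    subrings of one domain lets the induction on the number of variables run
    inside rings of the form [{poly P}]. *)
Definition specializes (P : comNzRingType) (c : {rmorphism K -> P}) : Prop :=
  forall (A : comNzRingType) (psi : {rmorphism P -> A}) (f : P),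
    (forall a b : A, a * b = 0 -> a = 0 \/ b = 0) -> psi f != 0 ->
    exists phi : {rmorphism P -> K},
      [/\ forall k, phi (c k) = k, forall g, psi g = 0 -> phi g = 0
        & phi f != 0].

Lemma specializes_base : specializes (idfun : {rmorphism K -> K}).
Proof.
move=> A psi f _ nz; exists idfun; split=> //= [g /eqP|].
  by rewrite fmorph_eq0 => /eqP.
by rewrite -(fmorph_eq0 psi).
Qed.

Section Step.
Import Pdiv.ComRing Pdiv.Ring.
Variables (P : comNzRingType) (c : {rmorphism K -> P}).
Hypothesis Pc : specializes c.
Variables (A : comNzRingType) (Psi : {rmorphism {poly P} -> A}).
Hypothesis domA : forall a b : A, a * b = 0 -> a = 0 \/ b = 0.

Let psi : {rmorphism P -> A} := Psi \o polyC.

Let dom_neq0 (a b : A) : a != 0 -> b != 0 -> a * b != 0.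
Proof. by move=> /eqP na /eqP nb; apply/eqP => /domA []. Qed.

Let size_map_poly_le g : (size (map_poly psi g) <= size g)%N.
Proof. exact: size_poly. Qed.

Let psiX a k : psi a != 0 -> psi (a ^+ k) != 0.
Proof.
move=> na; elim: k => [|k IHk]; first by rewrite rmorph1 oner_neq0.
by rewrite exprS rmorphM /= dom_neq0.
Qed.

(* So [Psi] is evaluation at x = [Psi 'X] of polynomials with coefficients in
   the image of P. *)
Let PsiE g : Psi g = (map_poly psi g).[Psi 'X].
Proof.
elim/poly_ind: g => [|g a IHg]; first by rewrite !rmorph0 horner0.
by rewrite !rmorphD !rmorphM /= map_polyX map_polyC /= hornerMXaddC IHg.
Qed.

Let size_mapM (p q : {poly A}) : p != 0 -> q != 0 ->
  size (p * q) = (size p + size q).-1.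
Proof.
move=> p0 q0; rewrite size_proper_mul //; apply/eqP => /domA [] /eqP;
by rewrite lead_coef_eq0; apply/negP.
Qed.

(* A polynomial over P may drop in degree in [{poly A}]; after truncation it
   does not, and pseudo-division over P then behaves as division over the field
   of fractions of the image of P. *)
Let truncation g : exists2 g' : {poly P},
  map_poly psi g' = map_poly psi g & size g' = size (map_poly psi g).
Proof.
set n := size (map_poly psi g).
have e : map_poly psi (\poly_(i < n) g`_i) = map_poly psi g.
  apply/polyP => i; rewrite !coef_map coef_poly /=; case: ltnP => // ni.
  by rewrite rmorph0 -[RHS](coef_map psi) nth_default.
have := size_map_poly_le (\poly_(i < n) g`_i); rewrite e -/n => le_n.
by exists (\poly_(i < n) g`_i) => //; apply/eqP; rewrite eqn_leq size_poly.
Qed.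

Let lead_truncated (g : {poly P}) : g != 0 -> size g = size (map_poly psi g) ->
  psi (lead_coef g) != 0.
Proof.
move=> g0 sg; rewrite /lead_coef -(coef_map psi) sg -lead_coefE lead_coef_eq0.
by rewrite -size_poly_eq0 -sg size_poly_eq0.
Qed.

Let eval (phi : {rmorphism P -> K}) (y : K) : {rmorphism {poly P} -> K} :=
  horner_eval y \o map_poly phi.

Let evalC phi y a : eval phi y a%:P = phi a.
Proof. by rewrite /= map_polyC horner_evalE hornerC. Qed.

Let map_ker (phi : {rmorphism P -> K}) (g : {poly P}) :
  (forall a, psi a = 0 -> phi a = 0) -> map_poly psi g = 0 -> map_poly phi g = 0.
Proof.
move=> ker g0; apply/polyP => i; rewrite coef_map coef0 /=; apply: ker.
by rewrite -(coef_map psi) g0 coef0.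
Qed.

(** When x is transcendental over the image of P, it can be sent to any element
    of K: specialize the coefficients of f so that one of them stays nonzero,
    then avoid the finitely many roots of the resulting polynomial. *)
Lemma specializes_transcendental f : (forall g, Psi g = 0 -> map_poly psi g = 0) ->
  Psi f != 0 ->
  exists phi : {rmorphism {poly P} -> K},
    [/\ forall k, phi (c k)%:P = k, forall g, Psi g = 0 -> phi g = 0
      & phi f != 0].
Proof.
move=> tr f0; have mf0 : map_poly psi f != 0.
  by apply: contraNneq f0 => mf0; rewrite PsiE mf0 horner0.
have l0 : psi f`_(size (map_poly psi f)).-1 != 0.
  by rewrite -(coef_map psi) -lead_coefE lead_coef_eq0.
have [phi [phic ker phil]] := Pc domA l0.
have /closed_nonrootP [y ry] : map_poly phi f != 0.
  by apply: contraNneq phil => pf0; rewrite -(coef_map phi) pf0 coef0.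
exists (eval phi y); split=> [k|g /tr mg0|]; first by rewrite evalC phic.
  by rewrite /= (map_ker ker mg0) raddf0.
by rewrite /= horner_evalE.
Qed.

(* The minimal polynomial of x, with denominators cleared. *)
Let minimal_relation (p : {poly P}) : Prop :=
  [/\ Psi p = 0, map_poly psi p != 0, size p = size (map_poly psi p) &
    forall g, Psi g = 0 -> (size (map_poly psi g) < size p)%N ->
      map_poly psi g = 0].

(** Over a field this says that x generates an algebraic extension, in which
    the nonzero element f(x) is invertible: the extended Euclidean algorithm
    for f and the minimal relation p ends in a nonzero constant.  Here that
    constant is found as a member r of least degree among the multiples of f,
    read modulo the kernel of [Psi]; division of r by p and of p by r shows
    that its degree is less than that of p, and then that it is 0. *)
Lemma constant_multiple p f : minimal_relation p -> Psi f != 0 ->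
  exists u a, psi a != 0 /\ Psi (u * f) = psi a.
Proof.
move=> [Psip mpn0 sp pmin] f0.
have pn0 : p != 0 by apply: contraNneq mpn0 => ->; rewrite rmorph0.
have lp : psi (lead_coef p) != 0 by apply: lead_truncated.
have [|r1 [Psir1 [u1 ur1]] min1] := @exists_minimizer _
  (fun r => Psi r != 0 /\ exists u, Psi r = Psi (u * f)) (size \o map_poly psi).
  by exists f; split=> //; exists 1; rewrite mul1r.
have [r mr sr] := truncation r1.
have Psir : Psi r = Psi r1 by rewrite PsiE mr -PsiE.
have rn0 : r != 0 by apply: contraNneq Psir1 => r0; rewrite -Psir r0 rmorph0.
have mrn0 : map_poly psi r != 0 by rewrite -size_poly_eq0 mr -sr size_poly_eq0.
have lr : psi (lead_coef r) != 0 by apply: lead_truncated; rewrite ?mr.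
have small (s : {poly P}) : (size s < size r)%N ->
    (exists u, Psi s = Psi (u * f)) -> Psi s = 0.
  move=> lt_s us; apply/eqP; apply: contraTT lt_s => s0; rewrite -leqNgt sr.
  by apply: leq_trans (min1 s _) _ => //; apply: size_poly.
(* Otherwise the remainder of r by p is a multiple of f of smaller degree. *)
have lt_rp : (size r < size p)%N.
  have := redivpP r p; case: (redivp r p) => [[k q] s]; case.
  move=> k' q' s' e /(_ pn0) lt_s.
  rewrite ltnNge; apply/negP => le_pr.
  have Ps : Psi s' = psi (lead_coef p ^+ k') * Psi r.
    have := congr1 Psi e; rewrite -mul_polyC rmorphD !rmorphM /= Psip mulr0 add0r.
    by move=> <-.
  have := small s' (leq_trans lt_s le_pr).
  move=> /(_ (ex_intro _ ((lead_coef p ^+ k')%:P * u1) _)) Ps0.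
  have /eqP : psi (lead_coef p ^+ k') * Psi r = 0.
    by rewrite -Ps Ps0 // Ps Psir ur1 -mulrA [in RHS]rmorphM.
  by apply/negP; rewrite dom_neq0 ?psiX // Psir.
have [sr1|sr1] := leqP (size r) 1.
  exists u1, r`_0; rewrite -ur1 -Psir {2}(size1_polyC sr1); split=> //.
  by move: Psir1; rewrite -Psir {1}(size1_polyC sr1).
(* In positive degree, r divides p exactly, by minimality of r, and the quotient
   is a relation of smaller degree than p. *)
have := redivpP p r; case: (redivp p r) => [[k q] s]; case.
move=> k' q' s' e /(_ rn0) lt_s.
have Pe : Psi q' * Psi r = - Psi s'.
  have := congr1 Psi e; rewrite -mul_polyC rmorphD !rmorphM /= Psip mulr0.
  by move/esym/eqP; rewrite addr_eq0 => /eqP.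
have Ps0 : Psi s' = 0.
  apply: small lt_s _; exists (- q' * u1).
  by rewrite -mulrA rmorphM rmorphN -ur1 -Psir mulNr Pe opprK.
have Pq0 : Psi q' = 0.
  by move: Pe; rewrite Ps0 oppr0 => /domA [] // /eqP; rewrite Psir (negPf Psir1).
have ms0 : map_poly psi s' = 0.
  apply: pmin => //; apply: leq_ltn_trans (size_map_poly_le _) _.
  exact: ltn_trans lt_s lt_rp.
have me : psi (lead_coef r ^+ k') *: map_poly psi p =
          map_poly psi q' * map_poly psi r.
  have := congr1 (map_poly psi) e.
  by rewrite -mul_polyC rmorphD !rmorphM /= map_polyC ms0 addr0 mul_polyC.
have nz : psi (lead_coef r ^+ k') *: map_poly psi p != 0.
  rewrite -mul_polyC -size_poly_eq0 size_mapM ?polyC_eq0 ?psiX //.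
  by rewrite size_polyC psiX // size_poly_eq0.
have mq0 : map_poly psi q' = 0.
  apply: pmin => //; rewrite ltnNge; apply/negP => le_pq.
  have mq0 : map_poly psi q' != 0.
    rewrite -size_poly_eq0 -lt0n; apply: leq_trans le_pq.
    by rewrite lt0n size_poly_eq0.
  have : (size (map_poly psi q' * map_poly psi r)%R <= size p)%N.
    by rewrite -me sp; apply: size_scale_leq.
  rewrite size_mapM // mr -sr.
  move: sr1 le_pq; case: (size r) => [|[|m]] // _; rewrite !addnS /=.
  by move=> le1 /leq_trans -/(_ _ le1); rewrite ltnNge leq_addr.
by move: nz; rewrite me mq0 mul0r eqxx.
Qed.

(** When x is algebraic over the image of P, keep nonzero the leading
    coefficient of a minimal relation p and a constant multiple of f.  The
    specialized p then has a root in K, and x can be sent to it because every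
    relation is, up to a power of the leading coefficient, a multiple of p. *)
Lemma specializes_algebraic p0 f : Psi p0 = 0 -> map_poly psi p0 != 0 ->
  Psi f != 0 ->
  exists phi : {rmorphism {poly P} -> K},
    [/\ forall k, phi (c k)%:P = k, forall g, Psi g = 0 -> phi g = 0
      & phi f != 0].
Proof.
move=> Psip0 mp0 f0.
have [p minp] : exists p, minimal_relation p.
  have [|p1 [Psip1 mp1] min1] := @exists_minimizer _
    (fun p => Psi p = 0 /\ map_poly psi p != 0) (size \o map_poly psi).
    by exists p0.
  have [p mp sp] := truncation p1.
  exists p; rewrite /minimal_relation PsiE mp -PsiE; split=> // g Psig lt_g.
  have [//|mg0] := eqVneq (map_poly psi g) 0.
  by move: lt_g; rewrite sp ltnNge min1.
have [Psip mpn0 sp pmin] := minp.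
have pn0 : p != 0 by apply: contraNneq mpn0 => ->; rewrite rmorph0.
have lp : psi (lead_coef p) != 0 by apply: lead_truncated.
have [u [a [Psia Psiu]]] := constant_multiple minp f0.
have lpa : psi (lead_coef p * a) != 0 by rewrite rmorphM dom_neq0.
have [phi [phic ker]] := Pc domA lpa.
rewrite rmorphM mulf_eq0 negb_or => /andP [phip phia].
have mphip : size (map_poly phi p) = size p.
  by rewrite size_map_poly_id0.
have /closed_rootP [y /eqP py] : size (map_poly phi p) != 1%N.
  rewrite mphip; apply/eqP => /eqP p1; move: Psip.
  have /size_poly1P [a0 nz pE] : size p == 1%N by [].
  by move/eqP; apply/negP; move: lp; rewrite pE lead_coefC.
have ker' g : Psi g = 0 -> eval phi y g = 0.
  move=> Psig; have := redivpP g p; case: (redivp g p) => [[k q] s]; case.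
  move=> k' q' s' e /(_ pn0) lt_s.
  have ms0 : map_poly phi s' = 0.
    apply: map_ker ker _; apply: pmin; last exact: leq_ltn_trans lt_s.
    have := congr1 Psi e; rewrite -mul_polyC rmorphD !rmorphM Psip Psig !mulr0.
    by rewrite add0r.
  have := congr1 (eval phi y) e.
  rewrite -mul_polyC rmorphD !rmorphM evalC /= ms0 !horner_evalE py mulr0 horner0.
  rewrite addr0 => /eqP.
  by rewrite rmorphXn mulf_eq0 expf_eq0 (negPf phip) andbF /= => /eqP.
exists (eval phi y); split=> // [k|]; first by rewrite evalC phic.
have : eval phi y (u * f - a%:P) = 0 by apply: ker'; rewrite rmorphB Psiu subrr.
move/eqP; rewrite rmorphB rmorphM evalC subr_eq0 => /eqP e.
by apply: contraNneq phia => f0'; rewrite -e f0' mulr0.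
Qed.

Lemma specializes_step f : Psi f != 0 ->
  exists phi : {rmorphism {poly P} -> K},
    [/\ forall k, phi (c k)%:P = k, forall g, Psi g = 0 -> phi g = 0
      & phi f != 0].
Proof.
move=> f0.
have [tr|] := pselect (forall g, Psi g = 0 -> map_poly psi g = 0).
  exact: specializes_transcendental.
move=> /existsNP [p0 /not_implyP [Psip0 /eqP mp0]].
exact: specializes_algebraic mp0 f0.
Qed.

End Step.

Lemma specializes_poly (P : comNzRingType) (c : {rmorphism K -> P}) :
  specializes c -> specializes (polyC \o c : {rmorphism K -> {poly P}}).
Proof. by move=> Pc A Psi f domA; apply: specializes_step. Qed.

(** Adjoining the elements of s one at a time. *)
Lemma finite_presentation (A : comAlgType K) (s : seq A) :
  exists (P : comNzRingType) (c : {rmorphism K -> P}) (Psi : {rmorphism P -> A}),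
    [/\ specializes c, forall k, Psi (c k) = k%:A
      & forall a, a \in s -> exists p, Psi p = a].
Proof.
elim: s => [|a s [P [c [Psi [Pc Psic Psis]]]]].
  by exists K, idfun, (in_alg A); split=> //; apply: specializes_base.
have cfu : commr_rmorph Psi a by move=> b; apply: mulrC.
exists {poly P}, (polyC \o c), (horner_morph cfu).
split; first exact: specializes_poly.
  by move=> k; rewrite /= horner_morphC.
move=> b; rewrite inE => /predU1P [->|/Psis [p <-]].
  by exists 'X; rewrite /= horner_morphX.
by exists p%:P; rewrite /= horner_morphC.
Qed.

Lemma rmorphism_of (A B : pzRingType) (h : A -> B) :
  zmod_morphism h -> monoid_morphism h -> exists f : {rmorphism A -> B}, f =1 h.
Proof.
move=> hB hM; pose ha := GRing.isZmodMorphism.Build _ _ h hB.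
pose hm := GRing.isMonoidMorphism.Build _ _ h hM.
by exists (HB.pack_for {rmorphism A -> B} h ha hm).
Qed.
Lemma rmorph_factor (P A B : pzRingType) (Psi : {rmorphism P -> A})
    (phi : {rmorphism P -> B}) :
  (forall a, exists p, Psi p = a) -> (forall p, Psi p = 0 -> phi p = 0) ->
  exists h : {rmorphism A -> B}, forall p, h (Psi p) = phi p.
Proof.
move=> /choice [l lK] ker.
have ker2 p q : Psi p = Psi q -> phi p = phi q.
  by move=> e; apply/eqP; rewrite -subr_eq0 -rmorphB ker // rmorphB e subrr.
pose h a := phi (l a).
have hB : zmod_morphism h.
  by move=> a b; rewrite /h -rmorphB; apply: ker2; rewrite rmorphB !lK.
have hM : monoid_morphism h.
  split=> [|a b]; rewrite /h -?rmorphM -?(rmorph1 phi); apply: ker2.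
    by rewrite lK rmorph1.
  by rewrite rmorphM !lK.
have [f fE] := rmorphism_of hB hM.
by exists f => p; rewrite fE; apply: ker2; rewrite lK.
Qed.

Theorem nullstellensatz (A : comAlgType K) (s : seq A) (a : A) :
  (forall a b : A, a * b = 0 -> a = 0 \/ b = 0) ->
  (forall Q : {pred A}, GRing.subalg_closed Q -> {subset s <= Q} ->
     forall b, b \in Q) ->
  a != 0 ->
  exists h : {rmorphism A -> K}, (forall k, h k%:A = k) /\ h a != 0.
Proof.
move=> domA gen a0; have [P [c [Psi [Pc Psic Psis]]]] := finite_presentation s.
have surj b : exists p, Psi p = b.
  pose Q : {pred A} := fun b => `[< exists p, Psi p = b >].
  suff : b \in Q by move=> /asboolP.
  apply: gen => [|b' /Psis pb]; last exact/asboolP.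
  split=> [|k u v /asboolP [p <-] /asboolP [q <-]|u v].
  - by apply/asboolP; exists 1; rewrite rmorph1.
  - by apply/asboolP; exists (c k * p + q); rewrite rmorphD rmorphM Psic mulr_algl.
  - move=> /asboolP [p <-] /asboolP [q <-]; apply/asboolP.
    by exists (p * q); rewrite rmorphM.
have [f fa] := surj a.
have [|phi [phic ker phif]] := Pc _ Psi f domA; first by rewrite fa.
have [h hE] := rmorph_factor surj ker.
by exists h; split=> [k|]; rewrite -?fa ?hE // -Psic hE phic.
Qed.

End Nullstellensatz.

(** * Coordinates on spectra, products, tori and affine spaces *)
Section Functors.
Context {R : realType}.
Local Notation C := R[i].
Implicit Types X Y Z : cfunctor R.

Program Definition rf_comp Y Z (f : mor Y Z) (h : regfun Z) : regfun Y :=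
  {| rf_fun := fun S y => h S (f S y) |}.
Next Obligation. by move=> Y Z f h S S' u y; rewrite /= mor_pull rf_pull. Qed.

Program Definition rf_cst Y (c : C) : regfun Y :=
  {| rf_fun := fun S y => base y c |}.
Next Obligation. by move=> Y c S S' u y; rewrite /= base_pull. Qed.

Program Definition rf_mul Y (f g : regfun Y) : regfun Y :=
  {| rf_fun := fun S y => f S y * g S y |}.
Next Obligation. by move=> Y f g S S' u y; rewrite /= !rf_pull rmorphM. Qed.

Program Definition rf_add Y (f g : regfun Y) : regfun Y :=
  {| rf_fun := fun S y => f S y + g S y |}.
Next Obligation. by move=> Y f g S S' u y; rewrite /= !rf_pull rmorphD. Qed.

Program Definition rf_sum Y (I : Type) (l : seq I) (P : pred I)
    (f : I -> regfun Y) : regfun Y :=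
  {| rf_fun := fun S y => \sum_(i <- l | P i) f i S y |}.
Next Obligation.
move=> Y I l P f S S' u y; rewrite /= rmorph_sum.
by apply: eq_bigr => i _; rewrite rf_pull.
Qed.

Program Definition rf_prod Y (I : Type) (l : seq I) (f : I -> regfun Y) :
    regfun Y :=
  {| rf_fun := fun S y => \prod_(i <- l) f i S y |}.
Next Obligation.
move=> Y I l f S S' u y; rewrite /= rmorph_prod.
by apply: eq_bigr => i _; rewrite rf_pull.
Qed.

Program Definition rf_exp Y (f : regfun Y) (k : nat) : regfun Y :=
  {| rf_fun := fun S y => f S y ^+ k |}.
Next Obligation. by move=> Y f k S S' u y; rewrite /= !rf_pull rmorphXn. Qed.

Program Definition pr1 Y Z : mor (cprod Y Z) Y :=
  {| mor_fun := fun S p => (sval p).1 |}.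
Next Obligation. by []. Qed.
Next Obligation. by []. Qed.

Program Definition pr2 Y Z : mor (cprod Y Z) Z :=
  {| mor_fun := fun S p => (sval p).2 |}.
Next Obligation. by []. Qed.
Next Obligation. by move=> Y Z S [[y z] h]. Qed.

Program Definition rf_spec (A : comAlgType C) (a : A) : regfun (spec A) :=
  {| rf_fun := fun S (x : pts (spec A) S) => x a |}.
Next Obligation. by []. Qed.

(** All elements of A are taken as coordinates: the identities between them
    include the addition and multiplication tables of A, so a family of values
    obeying them is a ring morphism. *)
Lemma coordinates_spec (A : comAlgType C) : coordinates (@rf_spec A).
Proof.
split=> [S y y' _ e|S b v law]; first exact: rmorphism_eq.
have [||h hE] := @rmorphism_of A S v.
- move=> a a'; rewrite -[v a']mul1r -mulNr -(rmorphN1 b).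
  apply: (law (Var (a - a')) (Add (Var a) (Mul (Cst (-1)) (Var a')))) => S' y.
  by rewrite /tval /= rmorphB scaleN1r rmorphN1 mulN1r.
- split=> [|a a'].
    rewrite -(rmorph1 b); apply: (law (Var 1) (Cst 1)) => S' y.
    by rewrite /tval /= scale1r.
  apply: (law (Var (a * a')) (Mul (Var a) (Var a'))) => S' y.
  by rewrite /tval /= rmorphM.
- exists h; split=> [|a]; last exact: hE.
  apply: rmorphism_eq => c /=; rewrite hE.
  exact: (law (Var c%:A) (Cst c)).
Qed.

Lemma coordinates_iso Y Z (f : mor Y Z) (g : mor Z Y) (I : Type)
    (z : I -> regfun Z) :
  (forall S y, g S (f S y) = y) -> (forall S y, f S (g S y) = y) ->
  coordinates z -> coordinates (fun i => rf_comp f (z i)).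
Proof.
move=> fK gK [inj surj]; split=> [S y y' eb ev|S b v law].
  rewrite -(fK _ y) -(fK _ y'); congr (g _ _).
  by apply: inj => //; rewrite !mor_base.
have [s t st|y [yb yv]] := surj S b v.
  apply: law => S' y; rewrite /tval /=.
  by have := st S' (f S' y); rewrite /tval mor_base.
exists (g S y); split=> [|i]; first by rewrite mor_base.
by rewrite /= gK.
Qed.

Fixpoint tmap (I J : Type) (r : I -> J) (t : term C I) : term C J :=
  match t with
  | Cst c => Cst c
  | Var i => Var (r i)
  | Add s t => Add (tmap r s) (tmap r t)
  | Mul s t => Mul (tmap r s) (tmap r t)
  end.

Lemma teval_tmap (I J : Type) (r : I -> J) (S : comPzRingType)
    (b : {rmorphism C -> S}) (v : J -> S) t :
  teval b v (tmap r t) = teval b (v \o r) t.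
Proof. by elim: t => //= s -> t ->. Qed.

Definition prod_coord Y Z (I J : Type) (y : I -> regfun Y) (z : J -> regfun Z)
    (k : I + J) : regfun (cprod Y Z) :=
  match k with
  | inl i => rf_comp (pr1 Y Z) (y i)
  | inr j => rf_comp (pr2 Y Z) (z j)
  end.

Lemma coordinates_prod Y Z (I J : Type) (y : I -> regfun Y) (z : J -> regfun Z) :
  coordinates y -> coordinates z -> coordinates (prod_coord y z).
Proof.
move=> [injy surjy] [injz surjz]; split=> [S p p' eb ev|S b v law].
  have ebp (q : pts (cprod Y Z) S) : base (sval q).2 = base q by case: q => [[]].
  apply: prod_pts_eq; first by apply: injy => // i; apply: (ev (inl i)).
  by apply: injz => [|j]; [rewrite !ebp | apply: (ev (inr j))].
have [s t st|p [pb pv]] := surjy S b (v \o inl).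
  rewrite -(teval_tmap inl b v s) -(teval_tmap inl b v t).
  by apply: law => S' q; rewrite /tval !teval_tmap; apply: st.
have [s t st|q [qb qv]] := surjz S b (v \o inr).
  rewrite -(teval_tmap inr b v s) -(teval_tmap inr b v t).
  apply: law => S' q; rewrite /tval !teval_tmap.
  by have := st S' (sval q).2; rewrite /tval -(svalP q).
have h : base p = base q by rewrite pb qb.
by exists (pt_pair h); split=> //; case=> i /=; rewrite ?pv ?qv.
Qed.

Program Definition rf_coord n (i : 'I_n) : regfun (affine_space R n) :=
  {| rf_fun := fun S x => x.2 i |}.
Next Obligation. by []. Qed.

Lemma coordinates_affine n : coordinates (@rf_coord n).
Proof.
split=> [S [b v] [b' v'] /= -> ev|S b v _]; last by exists (b, v).
by congr pair; apply/funext.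
Qed.

Program Definition rf_Gm n (i : 'I_n) : regfun (Gm R n) :=
  {| rf_fun := fun S x => Gm_val x i |}.
Next Obligation. by []. Qed.

Program Definition rf_GmV n (i : 'I_n) : regfun (Gm R n) :=
  {| rf_fun := fun S x => (sval x.2).2 i |}.
Next Obligation. by []. Qed.

Definition Gm_coord n (k : 'I_n + 'I_n) : regfun (Gm R n) :=
  match k with inl i => rf_Gm i | inr i => rf_GmV i end.

Lemma coordinates_Gm n : coordinates (@Gm_coord n).
Proof.
split=> [S y y' eb ev|S b v law].
  by apply: Gm_pts_eq => //; apply/funext => i; apply: (ev (inl i)).
have h i : v (inl i) * v (inr i) = 1.
  rewrite -(rmorph1 b).
  apply: (law (Mul (Var (inl i)) (Var (inr i))) (Cst 1)) => S' y.
  by rewrite /tval /= rmorph1; case: y => [c [[u u1] /= ->]].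
by exists (b, exist _ (v \o inl, v \o inr) h); split=> // -[].
Qed.

End Functors.

(** * Characters and Laurent monomials *)
Section IntegerPowers.
Variable S : comPzRingType.
Implicit Types (u v : S) (a b : int).

(** The power of u of exponent a, with v in the role of the inverse of u: a
    point of G_m carries both, and the ring of values need not have a decidable
    notion of unit. *)
Definition zpow u v a : S :=
  match a with Posz k => u ^+ k | Negz k => v ^+ k.+1 end.

(** Exponents written as differences of natural numbers reduce the laws of
    integral powers to those of natural powers. *)
Lemma zpowE u v p q : u * v = 1 -> zpow u v (p%:Z - q%:Z) = u ^+ p * v ^+ q.
Proof.
move=> uv; have uvX k : u ^+ k * v ^+ k = 1 by rewrite -exprMn uv expr1n.
have [le_qp|lt_pq] := leqP q p.
  by rewrite subzn //= -{2}(subnK le_qp) exprD -mulrA uvX mulr1.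
have [k ->] : exists k, q = (p + k.+1)%N.
  by exists (q - p).-1; rewrite prednK ?subn_gt0 // subnKC // ltnW.
have -> : p%:Z - (p + k.+1)%N%:Z = Negz k.
  by rewrite NegzE PoszD opprD addrA subrr add0r.
by rewrite exprD mulrA uvX mul1r.
Qed.

Lemma int_diff a : exists p q : nat, a = p%:Z - q%:Z.
Proof.
by case: a => k; [exists k, 0%N; rewrite subr0 | exists 0%N, k.+1; rewrite NegzE sub0r].
Qed.

Lemma zpowD u v a b : u * v = 1 -> zpow u v (a + b) = zpow u v a * zpow u v b.
Proof.
move=> uv; have [p [q ->]] := int_diff a; have [p' [q' ->]] := int_diff b.
by rewrite addrACA -opprD -!PoszD !zpowE // !exprD; ring.
Qed.

Lemma zpowV u v a : u * v = 1 -> zpow u v a * zpow v u a = 1.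
Proof.
move=> uv; have [p [q ->]] := int_diff a; have vu : v * u = 1 by rewrite mulrC.
by rewrite !zpowE // mulrACA -!exprMn uv vu !expr1n mulr1.
Qed.

Lemma zpowM u v u' v' a : zpow (u * u') (v * v') a = zpow u v a * zpow u' v' a.
Proof. by case: a => k; rewrite /= exprMn. Qed.

End IntegerPowers.

Lemma zpow_morph (S S' : comPzRingType) (f : {rmorphism S -> S'}) u v a :
  f (zpow u v a) = zpow (f u) (f v) a.
Proof. by case: a => k; rewrite /= rmorphXn. Qed.

Section Tori.
Context {R : realType}.
Local Notation C := R[i].
Implicit Types (G H T : cgroup R) (X Y Z : cfunctor R).

Program Definition ghom_comp G H T (f : ghom G H) (g : ghom H T) : ghom G T :=
  {| ghom_mor := {| mor_fun := fun S x => g S (f S x) |} |}.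
Next Obligation. by move=> G H T f g S S' u x /=; rewrite !mor_pull. Qed.
Next Obligation. by move=> G H T f g S x /=; rewrite !mor_base. Qed.
Next Obligation.
move=> G H T f g S x y h h' /=.
have h1 : base (f S x) = base (f S y) by rewrite !mor_base.
by rewrite (ghomM h h1) (ghomM h1 h').
Qed.

Lemma char_valM G (m : character G) S (x y : pts G S) (h : base x = base y) :
  char_val m (gmul G S (pt_pair h)) = char_val m x * char_val m y.
Proof.
have h' : base (m S x) = base (m S y) by rewrite !mor_base.
by rewrite /char_val (ghomM h h').
Qed.

Lemma char_val1 G (m : character G) (S : comPzRingType) (b : {rmorphism C -> S}) :
  char_val m (gunit G S b) = 1.
Proof. by rewrite /char_val ghom1. Qed.

Lemma char_val_pull G (m : character G) (S S' : comPzRingType)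
    (f : {rmorphism S -> S'}) (x : pts G S) :
  char_val m (pull f x) = f (char_val m x).
Proof. by rewrite /char_val mor_pull. Qed.

Definition char_inv G (m : character G) S (g : pts G S) : S :=
  (sval (m S g).2).2 ord0.

Lemma char_valV G (m : character G) S (g : pts G S) :
  char_val m g * char_inv m g = 1.
Proof. by rewrite /char_val /char_inv /Gm_val; case: (m S g) => [c [[u v] h]] /=. Qed.

Program Definition rf_char G (m : character G) : regfun G :=
  {| rf_fun := fun S g => char_val m g |}.
Next Obligation. by move=> G m S S' f x; apply: char_val_pull. Qed.

Section Tuple.
Variables (G : cgroup R) (n : nat) (chi : 'I_n -> character G).

Lemma tuple_subproof S (g : pts G S) i :
  (fun i => char_val (chi i) g, fun i => char_inv (chi i) g).1 i *
  (fun i => char_val (chi i) g, fun i => char_inv (chi i) g).2 i = 1.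
Proof. exact: char_valV. Qed.

Program Definition char_tuple : ghom G (Gm R n) :=
  {| ghom_mor := {| mor_fun := fun S g =>
       ((base g, exist _ _ (tuple_subproof g)) : pts (Gm R n) S) |} |}.
Next Obligation.
move=> S S' f x /=; apply: Gm_pts_eq => /=; first by rewrite base_pull.
by apply/funext => i; rewrite /Gm_val /= char_val_pull.
Qed.
Next Obligation. by []. Qed.
Next Obligation.
move=> S x y h h' /=; apply: Gm_pts_eq => /=; first by rewrite mor_base.
by apply/funext => i; rewrite /Gm_val /= char_valM.
Qed.

Lemma char_tuple_val S (g : pts G S) i :
  Gm_val (char_tuple S g) i = char_val (chi i) g.
Proof. by []. Qed.

End Tuple.

Section Monomials.
Variables (n : nat) (a : 'rV[int]_n).

Definition zprod (S : comPzRingType) (u v : 'I_n -> S) (_ : 'I_1) : S :=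
  \prod_k zpow (u k) (v k) (a 0 k).

Lemma monomial_subproof S (x : pts (Gm R n) S) (i : 'I_1) :
  (zprod (sval x.2).1 (sval x.2).2, zprod (sval x.2).2 (sval x.2).1).1 i *
  (zprod (sval x.2).1 (sval x.2).2, zprod (sval x.2).2 (sval x.2).1).2 i = 1.
Proof.
rewrite /= -big_split big1 //= => k _; rewrite zpowV //.
by case: x => [c [[u v] h]].
Qed.

Program Definition monomial : character (Gm R n) :=
  {| ghom_mor := {| mor_fun := fun S x =>
       ((x.1, exist _ _ (monomial_subproof x)) : pts (Gm R 1) S) |} |}.
Next Obligation.
move=> S S' f x /=; apply: Gm_pts_eq => //=.
apply/funext => i; rewrite /Gm_val /zprod /= rmorph_prod.
by apply: eq_bigr => k _; rewrite zpow_morph.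
Qed.
Next Obligation. by []. Qed.
Next Obligation.
move=> S x y h h' /=; apply: Gm_pts_eq => //=.
apply/funext => i; rewrite /Gm_val /zprod /= -big_split.
by apply: eq_bigr => k _; rewrite zpowM.
Qed.

End Monomials.

End Tori.

(** * Independence of characters and Laurent expansions *)
Lemma sum_by_key (V : pzSemiRingType) (K : eqType) (T : Type) (l : seq (K * T))
    (s : seq K) (chi : K -> V) (F : T -> V) :
  uniq s -> {subset map fst l <= s} ->
  \sum_(q <- l) chi q.1 * F q.2 =
  \sum_(a <- s) chi a * \sum_(q <- l | q.1 == a) F q.2.
Proof.
move=> us; elim: l => [|q l IHl] sub.
  by rewrite big_nil big1 // => a _; rewrite big_nil mulr0.
rewrite big_cons IHl => [|a al]; last by apply: sub; rewrite inE al orbT.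
have qs : q.1 \in s by apply: sub; rewrite inE eqxx.
rewrite !(bigD1_seq q.1 qs us) /= addrA big_cons eqxx mulrDr; congr (_ + _).
by apply: eq_bigr => a /negPf; rewrite big_cons eq_sym => ->.
Qed.

Section Independence.
Variables (R : realType) (G : Type) (op : G -> G -> G) (o : G).
Local Notation C := R[i].
Variables (S : comPzRingType) (b : {rmorphism C -> S}) (I : eqType).
Variable chi : I -> G -> C.
Hypothesis chiM : forall i g g', chi i (op g g') = chi i g * chi i g'.

Lemma unit_cancel (c : C) (x : S) : c != 0 -> b c * x = 0 -> x = 0.
Proof.
move=> c0 cx; rewrite -[x]mul1r -(rmorph1 b) -(mulVf c0) rmorphM -mulrA cx.
by rewrite mulr0.
Qed.

(** Dedekind's argument.  Evaluating the relation at g g' and subtracting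
    chi_1(g') times its value at g removes the first term and multiplies h0 by
    m(g') - chi_1(g'), which is an invertible scalar for a suitable g'.  The
    chi_i may coincide with each other; only m is required to be apart. *)
Lemma character_separation (m : G -> C) (l : seq I) (h : I -> S) (h0 : S) :
  (forall g g', m (op g g') = m g * m g') -> m o = 1 ->
  (forall i, i \in l -> exists g, chi i g != m g) ->
  (forall g, \sum_(i <- l) b (chi i g) * h i = b (m g) * h0) -> h0 = 0.
Proof.
move=> mM m1; elim: l h h0 => [|i l IHl] h h0 neq e.
  by have := e o; rewrite big_nil m1 rmorph1 mul1r.
have [g' ne] := neq i (mem_head i l).
apply: (@unit_cancel (m g' - chi i g')); first by rewrite subr_eq0 eq_sym.
apply: (IHl (fun k => b (chi k g' - chi i g') * h k)) => [k kl|g].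
  by apply: neq; rewrite inE kl orbT.
have := e (op g g'); have := e g; rewrite !big_cons.
set s1 := \sum_(_ <- _) _; set s2 := \sum_(_ <- _) _ => e1 e2.
transitivity (s2 - b (chi i g') * s1).
  rewrite mulr_sumr -sumrB; apply: eq_bigr => k _.
  by rewrite chiM rmorphM rmorphB; ring.
move/(canRL (addKr _)): e1 => ->; move/(canRL (addKr _)): e2 => ->.
by rewrite mM chiM !rmorphM rmorphB; ring.
Qed.

Lemma character_independence (l : seq I) (h : I -> S) :
  (forall i, chi i o = 1) -> uniq l ->
  (forall i k, i \in l -> k \in l -> i != k -> exists g, chi i g != chi k g) ->
  (forall g, \sum_(i <- l) b (chi i g) * h i = 0) ->
  forall i, i \in l -> h i = 0.
Proof.
move=> chi1 ul sep e i il; apply/eqP; rewrite -oppr_eq0; apply/eqP.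
apply: (character_separation (m := chi i) (l := [seq k <- l | k != i]) (h := h)) => //.
  by move=> k; rewrite mem_filter => /andP [ki kl]; apply: sep.
move=> g; have := e g; rewrite (bigD1_seq i) //= big_filter addrC.
by move/eqP; rewrite addr_eq0 mulrN => /eqP.
Qed.

End Independence.

Section Torus.
Context {R : realType}.
Local Notation C := R[i].
Variables (T : cgroup R) (r : nat) (phi : ghom T (Gm R r)) (phi' : ghom (Gm R r) T).
Hypothesis phiK : forall S x, phi' S (phi S x) = x.
Hypothesis phiK' : forall S y, phi S (phi' S y) = y.

Definition torus_coord (k : 'I_r + 'I_r) : regfun T := rf_comp phi (Gm_coord k).

Lemma coordinates_torus : coordinates torus_coord.
Proof. exact: (coordinates_iso phiK phiK' (@coordinates_Gm _ _)). Qed.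

(** The character t^a, in the torus coordinates given by [phi]. *)
Definition tmon (a : 'rV[int]_r) : character T := ghom_comp phi (monomial a).

Lemma tmonE a S (g : pts T S) :
  char_val (tmon a) g =
  \prod_k zpow (torus_coord (inl k) S g) (torus_coord (inr k) S g) (a 0 k).
Proof. by []. Qed.

Lemma torus_coordV S (g : pts T S) k :
  torus_coord (inl k) S g * torus_coord (inr k) S g = 1.
Proof. by rewrite /= /Gm_val; case: (phi S g) => [c [[u v] h]]. Qed.

Lemma tmon0 S (g : pts T S) : char_val (tmon 0) g = 1.
Proof. by rewrite tmonE big1 // => k _; rewrite mxE. Qed.

Lemma tmonD a a' S (g : pts T S) :
  char_val (tmon (a + a')) g = char_val (tmon a) g * char_val (tmon a') g.
Proof.
rewrite !tmonE -big_split; apply: eq_bigr => k _.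
by rewrite mxE zpowD // torus_coordV.
Qed.

Lemma tmon_delta k S (g : pts T S) :
  char_val (tmon (delta_mx 0 k)) g = torus_coord (inl k) S g.
Proof.
rewrite tmonE (bigD1 k) //= big1 => [|l lk]; rewrite mxE eqxx ?eqxx ?mulr1 //.
by rewrite (negPf lk).
Qed.

Lemma tmon_deltaN k S (g : pts T S) :
  char_val (tmon (- delta_mx 0 k)) g = torus_coord (inr k) S g.
Proof.
rewrite tmonE (bigD1 k) //= big1 => [|l lk]; rewrite !mxE eqxx ?eqxx ?mulr1 //.
by rewrite (negPf lk).
Qed.

Section Laurent.
Variables (Y : cfunctor R) (I : Type) (y : I -> regfun Y).
Hypothesis coord_y : coordinates y.

Lemma laurent_list (t : term C (('I_r + 'I_r) + I)) :
  exists l : seq ('rV[int]_r * regfun Y), forall S (p : pts (cprod T Y) S),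
    tval (prod_coord torus_coord y) p t =
    \sum_(q <- l) char_val (tmon q.1) (sval p).1 * q.2 S (sval p).2.
Proof.
elim: t => [c|[[k|k]|i]|s [ls IHs] t [lt IHt]|s [ls IHs] t [lt IHt]].
- exists [:: (0, rf_cst Y c)] => S p.
  by rewrite big_seq1 tmon0 mul1r /tval /= -(svalP p).
- exists [:: (delta_mx 0 k, rf_cst Y 1)] => S p.
  by rewrite big_seq1 tmon_delta /= rmorph1 mulr1.
- exists [:: (- delta_mx 0 k, rf_cst Y 1)] => S p.
  by rewrite big_seq1 tmon_deltaN /= rmorph1 mulr1.
- by exists [:: (0, y i)] => S p; rewrite big_seq1 tmon0 mul1r.
- exists (ls ++ lt) => S p; by rewrite big_cat -IHs -IHt.
- exists [seq (q.1 + q'.1, rf_mul q.2 q'.2) | q <- ls, q' <- lt] => S p.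
  rewrite big_allpairs_dep -[LHS]/(tval _ _ s * tval _ _ t).
  rewrite IHs IHt mulr_suml; apply: eq_bigr => q _.
  rewrite mulr_sumr; apply: eq_bigr => q' _ /=.
  by rewrite tmonD mulrACA.
Qed.

(** C[T x Y] is the ring of Laurent polynomials over C[Y].  Equal exponents are
    collected, as independence of characters needs distinct ones. *)
Lemma laurent_expansion (F : regfun (cprod T Y)) :
  exists (l : seq 'rV[int]_r) (c : 'rV[int]_r -> regfun Y), uniq l /\
    forall S (p : pts (cprod T Y) S),
      F S p = \sum_(a <- l) char_val (tmon a) (sval p).1 * c a S (sval p).2.
Proof.
have [t Ft] := regfun_term (coordinates_prod coordinates_torus coord_y) F.
have [l tl] := laurent_list t.
exists (undup (map fst l)), (fun a => rf_sum l (fun q => q.1 == a) snd).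
split=> [|S p]; first exact: undup_uniq.
rewrite Ft tl; apply: (sum_by_key (fun a => char_val (tmon a) _)
  (fun f : regfun Y => f S (sval p).2)); first exact: undup_uniq.
by move=> a; rewrite mem_undup.
Qed.

End Laurent.
End Torus.

(** * Weight spaces *)
Section ComplexPoints.
Context {R : realType}.
Local Notation C := R[i].
Variable T : cgroup R.

Definition cpoint : Type := {k : pts T C | base k = idfun}.

Lemma cmul_base (k k' : cpoint) : base (sval k) = base (sval k').
Proof. by rewrite (svalP k) (svalP k'). Qed.

Lemma cmul_subproof (k k' : cpoint) :
  base (gmul T C (pt_pair (cmul_base k k'))) = idfun.
Proof. by rewrite mor_base /= (svalP k). Qed.

Definition cmul (k k' : cpoint) : cpoint := exist _ _ (cmul_subproof k k').

Lemma cunit_subproof : base (gunit T C idfun) = idfun.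
Proof. by rewrite mor_base. Qed.

Definition cunit : cpoint := exist _ _ cunit_subproof.

Lemma base_cst (S : comPzRingType) (b : {rmorphism C -> S}) (k : cpoint) :
  base (pull b (sval k)) = b.
Proof. by rewrite base_pull (svalP k); apply: rmorphism_eq. Qed.

Definition cval (m : character T) (k : cpoint) : C := char_val m (sval k).

Lemma cvalM m k k' : cval m (cmul k k') = cval m k * cval m k'.
Proof. exact: char_valM. Qed.

Lemma cval1 m : cval m cunit = 1.
Proof. exact: char_val1. Qed.

End ComplexPoints.

Section TorusActions.
Context {R : realType}.
Local Notation C := R[i].
Variables (T : cgroup R) (r : nat) (phi : ghom T (Gm R r)) (phi' : ghom (Gm R r) T).
Hypothesis phiK : forall S x, phi' S (phi S x) = x.
Hypothesis phiK' : forall S y, phi S (phi' S y) = y.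

Local Notation tmon := (tmon phi).

Lemma cpoint_of (z : 'I_r -> C) : (forall k, z k != 0) ->
  exists k : cpoint T, forall a, cval (tmon a) k = \prod_l z l ^ (a 0 l).
Proof.
move=> z0; have zV l : (z, fun l => (z l)^-1).1 l * (z, fun l => (z l)^-1).2 l = 1.
  by rewrite /= mulfV.
pose y : pts (Gm R r) C := (idfun : {rmorphism C -> C}, exist _ _ zV).
have b : base (phi' C y) = idfun by rewrite mor_base.
exists (exist (fun k : pts T C => base k = idfun) _ b) => a.
rewrite /cval tmonE; apply: eq_bigr => l _.
rewrite /= phiK' /Gm_val /=; case: (a 0 l) => k //=.
by rewrite exprVn.
Qed.

(** The points with one coordinate 2 and the others 1 are enough, as the powers
    of 2 are distinct. *)
Lemma tmon_separated (a a' : 'rV[int]_r) : a != a' ->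
  exists k : cpoint T, cval (tmon a) k != cval (tmon a') k.
Proof.
move=> neq; have [l al] : exists l, a 0 l != a' 0 l.
  apply/existsP; apply: contraNT neq => /existsPn h; apply/eqP/rowP => l.
  by apply/eqP; rewrite -[_ == _]negbK; apply: h.
have z0 k : (if k == l then 2 else 1 : C) != 0 by case: ifP; rewrite ?pnatr_eq0 ?oner_eq0.
have [k kE] := cpoint_of z0; exists k.
have kE' b : cval (tmon b) k = 2 ^ (b 0 l).
  rewrite kE (bigD1 l) //= eqxx big1 ?mulr1 // => j /negPf ->.
  by rewrite exp1rz.
rewrite !kE'; apply: contraNneq al => e; apply/eqP.
have e2 : 2 = real_complex R 2 by rewrite rmorph_nat.
move: e; rewrite e2 -!fmorphXz => /fmorph_inj e.
by apply: (ieexprIz _ _ e); rewrite ?ltr0n // (eqr_nat _ 2 1).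
Qed.

Lemma tmon_independent (S : comPzRingType) (b : {rmorphism C -> S})
    (l : seq 'rV[int]_r) (h : 'rV[int]_r -> S) :
  uniq l -> (forall k : cpoint T, \sum_(a <- l) b (cval (tmon a) k) * h a = 0) ->
  forall a, a \in l -> h a = 0.
Proof.
move=> ul e; apply: (character_independence (op := @cmul R T) (o := cunit T)
  (chi := fun a k => cval (tmon a) k)) e => //.
- by move=> a k k'; apply: cvalM.
- by move=> a; apply: cval1.
- by move=> a a' _ _; apply: tmon_separated.
Qed.

(** Complex points of a torus are dense: the Laurent coefficients of a function
    vanishing at all of them vanish, by independence of characters.  Functions
    on T are expanded as functions on the product of T with a point, the affine
    space of dimension 0. *)
Lemma regfun_dense (F : regfun T) :
  (forall k : cpoint T, F C (sval k) = 0) -> forall S (g : pts T S), F S g = 0.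
Proof.
move=> F0; have [l [c [ul Fl]]] := laurent_expansion phiK phiK'
  (@coordinates_affine R 0) (rf_comp (pr1 _ _) F).
pose o : pts (affine_space R 0) C := (idfun : {rmorphism C -> C}, fun=> 0).
have c0 : forall a, a \in l -> c a C o = 0.
  apply: (@tmon_independent C idfun) => // k.
  have h : base (sval k) = base o by rewrite (svalP k).
  by rewrite -(Fl C (pt_pair h)) /= F0.
move=> S g.
have h : base g = base (pull (base g) o).
  by rewrite base_pull; apply: rmorphism_eq.
rewrite -[LHS]/(rf_comp (pr1 _ _) F S (pt_pair h)) Fl big1_seq // => a /andP [_ al].
by rewrite rf_pull c0 // rmorph0 mulr0.
Qed.

Lemma character_dense (m m' : character T) : cval m =1 cval m' ->
  forall S (g : pts T S), char_val m g = char_val m' g.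
Proof.
move=> e S g.
pose F := rf_add (rf_char m) (rf_mul (rf_cst T (-1)) (rf_char m')).
have FE S' (g' : pts T S') : F S' g' = char_val m g' - char_val m' g'.
  by rewrite /= rmorphN1 mulN1r.
apply/eqP; rewrite -subr_eq0 -FE; apply/eqP; apply: regfun_dense => k.
by rewrite FE; apply/eqP; rewrite subr_eq0; apply/eqP/(e k).
Qed.

Variables (Y : cfunctor R) (nu : gaction T Y).

Lemma act_cst S (y : pts Y S) (k : cpoint T) : base (pull (base y) (sval k)) = base y.
Proof. exact: base_cst. Qed.

Lemma homogeneous_cst (m : character T) (f : regfun Y) : homogeneous nu m f ->
  forall (k : cpoint T) S (y : pts Y S),
    f S (nu S (pt_pair (act_cst y k))) = base y (cval m k) * f S y.
Proof. by move=> hf k S y; rewrite hf char_val_pull. Qed.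

(** If every chi_i differed from m, it would do so at some complex point of T,
    and translating f = sum h_i by these points would give a relation
    sum chi_i(t) h_i = m(t) f, forcing f = 0. *)
Lemma weight_of_sum (I : eqType) (l : seq I) (chi : I -> character T)
    (h : I -> regfun Y) (m : character T) (f : regfun Y) S (y : pts Y S) :
  (forall i, homogeneous nu (chi i) (h i)) -> homogeneous nu m f ->
  (forall S (y : pts Y S), f S y = \sum_(i <- l) h i S y) -> f S y <> 0 ->
  exists2 i, i \in l &
    forall S (g : pts T S), char_val (chi i) g = char_val m g.
Proof.
move=> hh hf fE fy; apply: contrapT => no.
case: fy; apply: (@character_separation R _ (@cmul R T) (cunit T) S (base y) I
  (fun i k => cval (chi i) k) _ (cval m) l (fun i => h i S y)).
- by move=> i k k'; apply: cvalM.
- by move=> k k'; apply: cvalM.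
- exact: cval1.
- move=> i il; apply/not_existsP => e; apply: no; exists i => //.
  by apply: character_dense => k; apply/eqP/negPn/negP.
move=> k; rewrite -homogeneous_cst // fE; apply: eq_bigr => i _.
by rewrite (homogeneous_cst (hh i)).
Qed.

(** In f(t y) = sum t^a c_a(y), compare the expansions of f(s (t y)) and of
    f((s t) y) for complex points s: the coefficients of s^a are c_a(t y) and
    t^a c_a(y), and they agree by independence. *)
Lemma homogeneous_decomposition (I : Type) (y : I -> regfun Y) (f : regfun Y) :
  coordinates y ->
  exists (l : seq 'rV[int]_r) (c : 'rV[int]_r -> regfun Y),
    (forall a, a \in l -> homogeneous nu (tmon a) (c a)) /\
    forall S (y : pts Y S), f S y = \sum_(a <- l) c a S y.
Proof.
move=> coord_y; have [l [c [ul Fl]]] := laurent_expansion phiK phiK' coord_y (rf_comp nu f).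
exists l, c; split=> [a al S g x h|S x]; last first.
  have h : base (gunit T S (base x)) = base x by rewrite mor_base.
  rewrite -{1}(act1 nu h) -[LHS]/(rf_comp nu f S (pt_pair h)) Fl /=.
  by apply: eq_bigr => a _; rewrite char_val1 mul1r.
apply/eqP; rewrite -subr_eq0; apply/eqP.
apply: (@tmon_independent S (base x) l
  (fun a => c a S (nu S (pt_pair h)) - char_val (tmon a) g * c a S x) ul _ a al) => k.
have hk : base (pull (base x) (sval k)) = base g by rewrite base_cst h.
have hk' : base (pull (base x) (sval k)) = base (nu S (pt_pair h)).
  by rewrite base_cst mor_base /= h.
have hkg : base (gmul T S (pt_pair hk)) = base x by rewrite mor_base /= base_cst.
have := congr1 (f S) (actM hkg hk').
rewrite -[LHS]/(rf_comp nu f S (pt_pair hkg)) -[RHS]/(rf_comp nu f S (pt_pair hk')).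
rewrite !Fl /= => /esym/eqP; rewrite -subr_eq0 -sumrB => /eqP e.
rewrite -[RHS]e; apply: eq_bigr => b _.
by rewrite char_valM !char_val_pull mulrBr mulrA.
Qed.

End TorusActions.

(** * Sublattices of the character lattice *)
Section LatticeDichotomy.
Variable R : realType.
Local Notation C := R[i].

(** A nontrivial root of unity, that is a root of 1 + X + ... + X^(n-1), when
    n = |a| > 1; any scalar when a = 0. *)
Lemma torsion_point (a : int) : `|a|%N != 1%N ->
  exists z : C, [/\ z != 0, z != 1 & z ^ a = 1].
Proof.
have [->|a0 a1] := eqVneq a 0.
  by exists 2; rewrite expr0z pnatr_eq0 (eqr_nat _ 2 1).
have n_gt1 : (1 < `|a|)%N by rewrite ltn_neqAle eq_sym a1 lt0n absz_eq0.
set n := `|a|%N in n_gt1.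
pose p : {poly C} := \poly_(i < n) 1.
have sp : size p = n by rewrite size_poly_eq ?oner_eq0.
have /closed_rootP [z /eqP pz] : size p != 1%N by rewrite sp gtn_eqF.
have pE x : p.[x] = \sum_(i < n) x ^+ i.
  by rewrite horner_poly; apply: eq_bigr => i _; rewrite mul1r.
have zn : z ^+ n = 1 by apply/eqP; rewrite -subr_eq0 subrX1 -pE pz mulr0.
exists z; split.
- apply/eqP => z0; move/eqP: zn.
  by rewrite z0 expr0n gtn_eqF 1?ltnW // eq_sym oner_eq0.
- apply/eqP => z1; move/eqP: pz; rewrite z1 pE.
  under eq_bigr do rewrite expr1n.
  by rewrite sumr_const card_ord pnatr_eq0 gtn_eqF // ltnW.
- move: zn; rewrite /n; case: (a) => m //= zm.
  by rewrite NegzE -invr_expz -exprnP zm invr1.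
Qed.

Lemma exprz_sum (I : Type) (l : seq I) (a : I -> int) (z : C) : z != 0 ->
  z ^ (\sum_(i <- l) a i) = \prod_(i <- l) z ^ a i.
Proof. by move=> z0; apply: (big_morph _ (fun a b => expfzDr a b z0)). Qed.

Variables (k r : nat) (B : 'M[int]_(k, r)).

(** Write B = L D U in Smith normal form.  If all r diagonal entries of D are
    units, then transposing D inverts it on the left.  Otherwise take z <> 1
    killed by a diagonal entry delta that is not a unit (0 when D has too few
    rows), and the point with coordinates z^(w_l), where w is the column of the
    inverse of U of the same index: the rows of B take on it the exponents
    B w, which are multiples of delta, while a row of U takes the exponent 1,
    so the point is not trivial. *)
Lemma lattice_dichotomy :
  (exists K : 'M[int]_(r, k), K *m B = 1%:M) \/
  (exists z : 'I_r -> C, [/\ forall l, z l != 0, exists l, z l != 1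
     & forall i, \prod_l z l ^ (B i l) = 1]).
Proof.
have [L uL [U uU [d _ defB]]] := int_Smith_normal_form B.
set D := \matrix_(i, j) _ in defB.
have [/forallP all1|] := boolP [forall j : 'I_r, (j < k)%N && (absz d`_j == 1%N)].
  left; pose D' : 'M[int]_(r, k) := \matrix_(i, j) (d`_i *+ (i == j :> nat)).
  exists (invmx U *m D' *m invmx L).
  rewrite defB -!mulmxA (mulmxA (invmx L)) mulVmx // mul1mx (mulmxA D').
  suff -> : D' *m D = 1%:M by rewrite mul1mx mulVmx.
  apply/matrixP => i j; rewrite !mxE.
  have /andP [ik /eqP di] := all1 i.
  rewrite (bigD1 (Ordinal ik)) //= big1 => [|l li]; last first.
    rewrite !mxE; case: eqP => [e|]; last by rewrite mul0r.
    by case/eqP: li; apply/val_inj.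
  rewrite !mxE eqxx addr0 mulr1n.
  have [<-|ne] := eqVneq i j; last first.
    by rewrite (_ : _ == _ = false) ?mulr0 //; apply/negbTE.
  by rewrite eqxx mulr1n; case: (d`_i) di => [[|[|m]]|[|m]].
move=> /forallPn [j dj]; right.
pose delta : int := if (j < k)%N then d`_j else 0.
have [|z [z0 z1 zd]] := @torsion_point delta.
  by move: dj; rewrite /delta; case: ifP.
pose w l := invmx U l j.
have zw l a : (z ^ w l) ^ a = z ^ (a * w l) by rewrite exprz_exp mulrC.
exists (fun l => z ^ w l); split=> [l||i].
- by rewrite expfz_neq0.
- apply: contrapT => no.
  have zw1 l : z ^ w l = 1 by apply/eqP/negPn/negP => ne; apply: no; exists l.
  case/eqP: z1; rewrite -[z]expr1z.
  have <- : (U *m invmx U) j j = 1 by rewrite mulmxV // mxE eqxx.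
  rewrite mxE exprz_sum // big1 // => l _.
  by rewrite mulrC -exprz_exp zw1 exp1rz.
- under eq_bigr do rewrite zw.
  rewrite -exprz_sum //.
  have -> : \sum_l B i l * w l = (L *m D) i j.
    transitivity ((B *m invmx U) i j); first by rewrite mxE.
    by rewrite defB -mulmxA mulmxV // mulmx1.
  have [q ->] : exists q, (L *m D) i j = delta * q.
    rewrite mxE /delta; case: ltnP => [jk|kj].
      exists (L i (Ordinal jk)); rewrite (bigD1 (Ordinal jk)) //= big1 => [|l lj].
        by rewrite !mxE eqxx addr0 mulrC.
      by rewrite !mxE (_ : _ == _ = false) ?mulr0 //; apply/negbTE.
    exists 0; rewrite mulr0 big1 // => l _; rewrite mxE (_ : _ == _ = false) ?mulr0 //.
    by apply/negbTE; rewrite neq_ltn (leq_trans (ltn_ord l) kj).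
  by rewrite -exprz_exp zd exp1rz.
Qed.

End LatticeDichotomy.

(** * The homomorphism to the standard torus *)
Section PowersOfPowers.
Variable S : comPzRingType.
Implicit Types (u v : S) (a b : int).

Lemma zpow_opp u v a : u * v = 1 -> zpow u v (- a) = zpow v u a.
Proof.
move=> uv; have vu : v * u = 1 by rewrite mulrC.
by have [p [q ->]] := int_diff a; rewrite opprB !zpowE // mulrC.
Qed.

Lemma zpow_zpow u v a b : u * v = 1 ->
  zpow (zpow u v a) (zpow v u a) b = zpow u v (b * a).
Proof.
move=> uv; have nat_case c n : zpow u v c ^+ n = zpow u v (n%:Z * c).
  elim: n => [|n IHn]; first by rewrite mul0r.
  by rewrite exprS IHn intS mulrDl mul1r zpowD.
case: b => n /=; first exact: nat_case.
by rewrite -zpow_opp // nat_case NegzE mulrN mulNr.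
Qed.

End PowersOfPowers.

Section ClosedSubgroup.
Context {R : realType}.
Local Notation C := R[i].
Variables (T : cgroup R) (r : nat) (phi : ghom T (Gm R r)) (phi' : ghom (Gm R r) T).
Hypothesis phiK : forall S x, phi' S (phi S x) = x.
Hypothesis phiK' : forall S y, phi S (phi' S y) = y.
Local Notation tmon := (tmon phi).

Lemma tmonZ b a S (g : pts T S) :
  zpow (char_val (tmon a) g) (char_inv (tmon a) g) b = char_val (tmon (b *: a)) g.
Proof.
have prodE (u v : 'I_r -> S) : zpow (\prod_l u l) (\prod_l v l) b =
    \prod_l zpow (u l) (v l) b.
  by rewrite /zpow; case: (b) => m; rewrite prodrXl.
rewrite tmonE /char_inv /= /zprod prodE; apply: eq_bigr => l _.
by rewrite mxE zpow_zpow ?torus_coordV.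
Qed.

Lemma tmon_sum (I : Type) (l : seq I) (a : I -> 'rV[int]_r) S (g : pts T S) :
  \prod_(i <- l) char_val (tmon (a i)) g = char_val (tmon (\sum_(i <- l) a i)) g.
Proof.
elim/big_rec2: _ => [|i x y _ ->]; first by rewrite tmon0.
by rewrite tmonD.
Qed.

Variables (k : nat) (B : 'M[int]_(k, r)).

(** A point of T at which the weights of all f_i are 1 fixes every f_i, hence
    every point of X; effectiveness leaves no such point but 1. *)
Lemma effective_generates X (mu : gaction T X) (f : 'I_k -> regfun X) :
  effective mu ->
  (forall i, homogeneous mu (tmon (row i B)) (f i)) ->
  (forall S (x y : pts X S), base x = base y -> (forall i, f i S x = f i S y) ->
     x = y) ->
  exists K : 'M[int]_(r, k), K *m B = 1%:M.
Proof.
move=> eff hf sep; have [//|[z [z0 [l zl] zB]]] := lattice_dichotomy R B.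
have [g gE] := cpoint_of phiK' z0.
have g1 : sval g = gunit T C (base (sval g)).
  apply: eff => [c|S x h]; first by rewrite (svalP g).
  apply: sep => [|i]; first by rewrite mor_base.
  rewrite hf char_val_pull -[char_val _ _]/(cval _ g) gE.
  under eq_bigr do rewrite mxE.
  by rewrite zB rmorph1 mul1r.
case/eqP: zl; have := gE (delta_mx 0 l).
rewrite /cval g1 char_val1 (bigD1 l) //= big1 => [|m ml].
  by rewrite mxE !eqxx mulr1 => ->.
by rewrite mxE (negPf ml) andbF.
Qed.

Variables (n : nat) (chi : 'I_n -> character T) (iota : 'I_k -> 'I_n).
Hypothesis chi_iota : forall i, chi (iota i) = tmon (row i B).

Program Definition rf_zpow i (a : int) : regfun (Gm R n) :=
  {| rf_fun := fun S y => zpow (rf_Gm i S y) (rf_GmV i S y) a |}.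
Next Obligation. by move=> i a S S' f x; rewrite /= zpow_morph. Qed.

(** The relation K B = 1 writes every character t^a of T as a monomial, with
    exponents a K, in the characters of index in the image of iota; and
    characters generate the functions on T. *)
Lemma tuple_closed_immersion (K : 'M[int]_(r, k)) : K *m B = 1%:M ->
  closed_immersion (char_tuple chi).
Proof.
move=> KB.
have mono a : exists h : regfun (Gm R n), forall S (g : pts T S),
    char_val (tmon a) g = h S (char_tuple chi S g).
  exists (rf_prod (index_enum 'I_k) (fun i => rf_zpow (iota i) ((a *m K) 0 i))) => S g.
  transitivity (\prod_i char_val (tmon ((a *m K) 0 i *: row i B)) g).
    by rewrite tmon_sum -mulmx_sum_row -mulmxA KB mulmx1.
  apply: eq_bigr => i _.
  by rewrite /= [Gm_val _ _]char_tuple_val chi_iota tmonZ.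
move=> F; have [t Ft] := regfun_term (coordinates_torus phiK phiK') F.
suff [h hE] : exists h : regfun (Gm R n), forall S (g : pts T S),
    tval (torus_coord phi) g t = h S (char_tuple chi S g).
  by exists h => S g; rewrite Ft.
elim: t {Ft} => [c|[l|l]|s [hs IHs] t [ht IHt]|s [hs IHs] t [ht IHt]].
- by exists (rf_cst _ c).
- have [h hE] := mono (delta_mx 0 l); exists h => S g.
  by rewrite -hE tmon_delta.
- have [h hE] := mono (- delta_mx 0 l); exists h => S g.
  by rewrite -hE tmon_deltaN.
- by exists (rf_add hs ht) => S g; rewrite /= -IHs -IHt.
- by exists (rf_mul hs ht) => S g; rewrite /= -IHs -IHt.
Qed.

End ClosedSubgroup.

(** * Homogeneous generators and complex points of an affine variety *)
Section AffineVariety.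
Context {R : realType}.
Local Notation C := R[i].

Definition nonzero (X : cfunctor R) (f : regfun X) : Prop :=
  exists S (x : pts X S), f S x <> 0.

Program Definition family_mor (X : cfunctor R) n (f : 'I_n -> regfun X) :
    mor X (affine_space R n) :=
  {| mor_fun := fun S x => ((base x, fun i => f i S x) : pts (affine_space R n) S) |}.
Next Obligation.
move=> X n f S S' u x /=; rewrite base_pull; congr pair.
by apply/funext => i; rewrite /= rf_pull.
Qed.
Next Obligation. by []. Qed.

Lemma closed_immersion_inj (X : cfunctor R) n (f : 'I_n -> regfun X) (I : Type)
    (c : I -> regfun X) :
  coordinates c -> closed_immersion (family_mor f) ->
  forall S (x y : pts X S), base x = base y -> (forall i, f i S x = f i S y) -> x = y.
Proof.
move=> [inj _] cl S x y eb ef; apply: inj => // i.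
have [h hE] := cl (c i); rewrite !hE; congr (h S _).
by rewrite /= eb; congr pair; apply/funext.
Qed.

Variables (X : cfunctor R) (A : comAlgType C).
Variables (alpha : mor X (spec A)) (beta : mor (spec A) X).
Hypothesis alphaK : forall S x, beta S (alpha S x) = x.
Hypothesis betaK : forall S y, alpha S (beta S y) = y.
Hypothesis domA : integral A.

Definition rf_of (a : A) : regfun X := rf_comp alpha (rf_spec a).

Lemma coordinates_variety : coordinates rf_of.
Proof. exact: (coordinates_iso alphaK betaK (@coordinates_spec _ _)). Qed.

Lemma rf_of_scalar c S (x : pts X S) : rf_of c%:A S x = base x c.
Proof. by rewrite -(mor_base alpha). Qed.

Lemma rf_ofD a b S (x : pts X S) : rf_of (a + b) S x = rf_of a S x + rf_of b S x.
Proof. exact: rmorphD. Qed.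
Lemma rf_ofM a b S (x : pts X S) : rf_of (a * b) S x = rf_of a S x * rf_of b S x.
Proof. exact: rmorphM. Qed.

Definition generic_point : pts X A := beta A (idfun : {rmorphism A -> A}).

(** The Yoneda lemma, with the generic point Spec A -> X. *)
Lemma regfun_generic (f : regfun X) S (x : pts X S) :
  f S x = rf_of (f A generic_point) S x.
Proof.
rewrite -[in LHS](alphaK x) /= -rf_pull -mor_pull; congr (f S (beta S _)).
exact: rmorphism_eq.
Qed.

Lemma nonzero_generic (f : regfun X) : nonzero f <-> f A generic_point <> 0.
Proof.
split=> [[S [x fx]] f0|]; last by exists A, generic_point.
by apply: fx; rewrite regfun_generic f0 /= rmorph0.
Qed.

Lemma nonzero_cst1 : nonzero (rf_cst X 1).
Proof. by rewrite nonzero_generic /= rmorph1; apply/eqP/oner_neq0. Qed.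

Lemma nonzero_exp (f : regfun X) k : nonzero f -> nonzero (rf_exp f k).
Proof.
move=> nf; elim: k => [|k].
  by rewrite nonzero_generic /= expr0; apply/eqP/oner_neq0.
by rewrite !nonzero_generic /= exprS; move/nonzero_generic: nf => nf fk /domA [].
Qed.

Lemma nonzero_prod (I : Type) (l : seq I) (f : I -> regfun X) :
  (forall i, nonzero (f i)) -> nonzero (rf_prod l f).
Proof.
move=> nf; rewrite nonzero_generic /=; elim: l => [|i l IHl].
  by rewrite big_nil; apply/eqP/oner_neq0.
by rewrite big_cons => /domA [|//]; apply/(nonzero_generic (f i)).1/nf.
Qed.

Lemma exists_complex_point (f : regfun X) :
  finitely_generated A -> nonzero f ->
  exists x : pts X C, complex_point x /\ f C x <> 0.
Proof.
move=> [s gen] /nonzero_generic/eqP f0.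
have [h [hC hf]] := nullstellensatz domA gen f0.
exists (beta C h); split=> [c|]; first by rewrite mor_base /= hC.
by rewrite regfun_generic /= betaK; apply/eqP.
Qed.

Section Generators.
Variables (T : cgroup R) (r : nat) (phi : ghom T (Gm R r)) (phi' : ghom (Gm R r) T).
Hypothesis phiK : forall S x, phi' S (phi S x) = x.
Hypothesis phiK' : forall S y, phi S (phi' S y) = y.
Variable mu : gaction T X.

(** The nonzero homogeneous components of the elements of a generating family.
    Constants are added to make the family as large as needed. *)
Lemma homogeneous_generators (d : nat) : finitely_generated A ->
  exists (k : nat) (f : 'I_k -> regfun X) (e : 'I_k -> 'rV[int]_r),
    [/\ (d <= k)%N, forall i, homogeneous mu (tmon phi (e i)) (f i),
        forall i, nonzero (f i) & closed_immersion (family_mor f)].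
Proof.
case=> s gen.
have /choice [lc lcP] : forall a : A, exists lc : seq 'rV[int]_r * ('rV[int]_r -> regfun X),
    (forall e, e \in lc.1 -> homogeneous mu (tmon phi e) (lc.2 e)) /\
    forall S (x : pts X S), rf_of a S x = \sum_(e <- lc.1) lc.2 e S x.
  move=> a; have [l [c h]] := homogeneous_decomposition phiK phiK' mu (rf_of a)
    coordinates_variety.
  by exists (l, c).
pose fn (o : option (A * 'rV[int]_r)) :=
  if o is Some (a, e) then (lc a).2 e else rf_cst X 1.
pose wt (o : option (A * 'rV[int]_r)) := if o is Some (a, e) then e else 0.
pose good (p : A * 'rV[int]_r) := `[< nonzero ((lc p.1).2 p.2) >].
pose pairs := [seq (a, e) | a <- s, e <- (lc a).1].
pose L := map Some (filter good pairs) ++ nseq d None.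
pose f (i : 'I_(size L)) := fn (nth None L i).
have LP o : o \in L -> o = None \/ exists a e,
    [/\ o = Some (a, e), e \in (lc a).1 & nonzero ((lc a).2 e)].
  rewrite mem_cat mem_nseq => /orP [/mapP [[a e]]|/andP [_ /eqP]]; last by left.
  rewrite mem_filter => /andP [/asboolP /= nz /allpairsPdep [a' [e' [_ el [ea ee]]]]] ->.
  by right; exists a, e; split=> //; rewrite ea ee.
exists (size L), f, (fun i => wt (nth None L i)); split.
- by rewrite size_cat size_nseq leq_addl.
- move=> i; rewrite /f; have := mem_nth None (ltn_ord i).
  move: (nth _ _ _) => o /LP [->|[a [e [-> el _]]]]; last exact: (lcP a).1.
  by move=> S g x h; rewrite tmon0 mul1r /= mor_base /= h.
- move=> i; rewrite /f; have := mem_nth None (ltn_ord i).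
  by move: (nth _ _ _) => o /LP [->|[a [e [-> _ nz]]]] //; apply: nonzero_cst1.
move=> F; pose Q : {pred A} := fun a => `[< exists h : regfun (affine_space R (size L)),
  forall S (x : pts X S), rf_of a S x = h S (family_mor f S x) >].
suff : F A generic_point \in Q.
  by move=> /asboolP [h hE]; exists h => S x; rewrite regfun_generic hE.
apply: gen.
  split=> [|c u v|u v].
  - apply/asboolP; exists (rf_cst _ 1) => S x.
    by rewrite /= !rmorph1.
  - move=> /asboolP [h hE] /asboolP [h' hE']; apply/asboolP.
    exists (rf_add (rf_mul (rf_cst _ c) h) h') => S x.
    by rewrite rf_ofD hE' -mulr_algl rf_ofM rf_of_scalar hE.
  - move=> /asboolP [h hE] /asboolP [h' hE']; apply/asboolP.
    by exists (rf_mul h h') => S x; rewrite rf_ofM hE hE'.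
move=> a sa; apply/asboolP.
suff [h hE] : exists h : regfun (affine_space R (size L)), forall S (x : pts X S),
    \sum_(e <- (lc a).1) (lc a).2 e S x = h S (family_mor f S x).
  by exists h => S x; rewrite (lcP a).2 hE.
have : {subset (lc a).1 <= (lc a).1} by [].
elim: {1 3}(lc a).1 => [|e l IHl] sub.
  by exists (rf_cst _ 0) => S x; rewrite big_nil /= rmorph0.
have [|h hE] := IHl; first by move=> e' e'l; apply: sub; rewrite inE e'l orbT.
have [nz|z] := pselect (nonzero ((lc a).2 e)); last first.
  exists h => S x; rewrite big_cons hE (_ : (lc a).2 e S x = 0) ?add0r //.
  by apply: contrapT => ne; apply: z; exists S, x.
have iL : (index (Some (a, e)) L < size L)%N.
  rewrite index_mem mem_cat map_f // mem_filter; apply/andP; split; first exact/asboolP.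
  by apply/allpairsPdep; exists a, e; split=> //; apply: sub; rewrite inE eqxx.
exists (rf_add (rf_coord (Ordinal iL)) h) => S x.
by rewrite big_cons hE /= /f /= nth_index // -index_mem.
Qed.

End Generators.
End AffineVariety.

(** * Conjugation combined with a permutation of coordinates *)
Section RealStructures.
Context {R : realType}.
Local Notation C := R[i].
Variables (n : nat) (s : 'I_n -> 'I_n).
Hypothesis sK : involutive s.

Program Definition affine_twist : real_structure (affine_space R n) :=
  {| rs_fun := fun S x =>
       ((x.1 \o @conjc R : {rmorphism C -> S}, x.2 \o s) : pts (affine_space R n) S) |}.
Next Obligation. by move=> S S' f x /=; congr pair; apply: rmorphism_eq. Qed.
Next Obligation. by []. Qed.
Next Obligation.
move=> S [c v] /=; congr pair; last by apply/funext => i; rewrite /= sK.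
by apply: rmorphism_eq => a; rewrite /= conjcK.
Qed.

Lemma Gm_twist_subproof S (x : pts (Gm R n) S) i :
  ((sval x.2).1 \o s, (sval x.2).2 \o s).1 i *
  ((sval x.2).1 \o s, (sval x.2).2 \o s).2 i = 1.
Proof. by case: x => [c [[u v] h]] /=; apply: h. Qed.

Program Definition Gm_twist : real_structure (Gm R n) :=
  {| rs_fun := fun S x =>
       ((x.1 \o @conjc R : {rmorphism C -> S}, exist _ _ (Gm_twist_subproof x))
        : pts (Gm R n) S) |}.
Next Obligation.
by move=> S S' f x; apply: Gm_pts_eq => //=; apply: rmorphism_eq.
Qed.
Next Obligation. by []. Qed.
Next Obligation.
move=> S x; apply: Gm_pts_eq => /=.
  by apply: rmorphism_eq => a; rewrite /= conjcK.
by apply/funext => i; rewrite /Gm_val /= sK.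
Qed.

Lemma Gm_twist_group : real_group_structure Gm_twist.
Proof. by split=> S x; apply: Gm_pts_eq. Qed.

Lemma std_embedding_real : real_mor Gm_twist affine_twist (std_embedding R n).
Proof. by move=> S x. Qed.

End RealStructures.

Section Twists.
Context {R : realType}.
Local Notation C := R[i].
Variables (X : cfunctor R) (T : cgroup R) (mu : gaction T X).
Variables (sigma : real_structure X) (tau : real_structure T).

Program Definition rf_twist (f : regfun X) : regfun X :=
  {| rf_fun := fun S x => f S (sigma S x) |}.
Next Obligation. by move=> f S S' u x; rewrite /= rs_pull rf_pull. Qed.

Lemma nonzero_twist f : nonzero f -> nonzero (rf_twist f).
Proof. by move=> [S [x fx]]; exists S, (sigma S x); rewrite /= rs_inv. Qed.

Hypothesis tau_group : real_group_structure tau.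

Lemma tauM S (x y : pts T S) (h : base x = base y)
    (h' : base (tau S x) = base (tau S y)) :
  tau S (gmul T S (pt_pair h)) = gmul T S (pt_pair h').
Proof.
case: tau_group => realM _ _; rewrite realM; congr (gmul T S _).
exact: prod_pts_eq.
Qed.

Section TwistedCharacter.
Variable m : character T.

Lemma twist_subproof S (g : pts T S) (i : 'I_1) :
  ((fun=> char_val m (tau S g) : S, fun=> char_inv m (tau S g) : S)
     : ('I_1 -> S) * ('I_1 -> S)).1 i *
  ((fun=> char_val m (tau S g) : S, fun=> char_inv m (tau S g) : S)
     : ('I_1 -> S) * ('I_1 -> S)).2 i = 1.
Proof. exact: char_valV. Qed.

Program Definition char_twist : character T :=
  {| ghom_mor := {| mor_fun := fun S g =>
       ((base g, exist _ _ (twist_subproof g)) : pts (Gm R 1) S) |} |}.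
Next Obligation.
move=> S S' f x /=; apply: Gm_pts_eq => /=; first by rewrite base_pull.
by apply/funext => i; rewrite /Gm_val /= rs_pull char_val_pull.
Qed.
Next Obligation. by []. Qed.
Next Obligation.
move=> S x y h h' /=; apply: Gm_pts_eq => /=; first by rewrite mor_base.
have ht : base (tau S x) = base (tau S y) by rewrite !rs_base h.
by apply/funext => i; rewrite /Gm_val /= (tauM h ht) char_valM.
Qed.

Lemma char_twistE S (g : pts T S) : char_val char_twist g = char_val m (tau S g).
Proof. by []. Qed.

End TwistedCharacter.

(** f(sigma(t x)) = f(tau(t) sigma(x)) = m(tau(t)) f(sigma(x)). *)
Lemma homogeneous_twist m f : real_action tau sigma mu ->
  homogeneous mu m f -> homogeneous mu (char_twist m) (rf_twist f).
Proof.
move=> real hf S g x h; rewrite char_twistE /=.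
have h' : base (tau S g) = base (sigma S x) by rewrite !rs_base h.
rewrite -(hf S _ _ h') real; congr (f S (mu S _)).
exact: prod_pts_eq.
Qed.

Variables (k : nat) (f : 'I_k -> regfun X) (chi : 'I_k -> character T).

Definition swap (i : 'I_(k + k)) : 'I_(k + k) :=
  match split i with inl a => rshift k a | inr a => lshift k a end.

Lemma swapK : involutive swap.
Proof.
move=> i; rewrite /swap; case: (split_ordP i) => a ->.
  by rewrite (unsplitK (inr a)).
by rewrite (unsplitK (inl a)).
Qed.

Definition double_fun (i : 'I_(k + k)) : regfun X :=
  match split i with inl a => f a | inr a => rf_twist (f a) end.

Definition double_char (i : 'I_(k + k)) : character T :=
  match split i with inl a => chi a | inr a => char_twist (chi a) end.

Lemma double_funE S x i : double_fun i S (sigma S x) = double_fun (swap i) S x.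
Proof.
rewrite /double_fun /swap; case: (split_ordP i) => a _.
  by rewrite (unsplitK (inr a)).
by rewrite (unsplitK (inl a)) /= rs_inv.
Qed.

Lemma double_charE S g i :
  char_val (double_char i) (tau S g) = char_val (double_char (swap i)) g.
Proof.
rewrite /double_char /swap; case: (split_ordP i) => a _.
  by rewrite (unsplitK (inr a)).
by rewrite (unsplitK (inl a)) char_twistE rs_inv.
Qed.

Lemma family_real : real_mor sigma (affine_twist swapK) (family_mor double_fun).
Proof.
move=> S x /=; congr pair; first by rewrite rs_base.
by apply/funext => i; rewrite /= double_funE.
Qed.

Lemma tuple_real : real_mor tau (Gm_twist swapK) (char_tuple double_char).
Proof.
move=> S g /=; apply: Gm_pts_eq => /=; first by rewrite rs_base.
by apply/funext => i; rewrite /Gm_val /= double_charE.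
Qed.

Lemma double_closed_immersion :
  closed_immersion (family_mor f) -> closed_immersion (family_mor double_fun).
Proof.
move=> cl F; have [h hE] := cl F.
pose q : mor (affine_space R (k + k)) (affine_space R k) :=
  family_mor (fun i => rf_coord (lshift k i)).
exists (rf_comp q h) => S x; rewrite hE /=; congr (h S (_, _)).
by apply/funext => i; rewrite /double_fun (unsplitK (inl i)).
Qed.

End Twists.

(** * Weights of the affine space *)
Section Weights.
Context {R : realType}.
Local Notation C := R[i].

Lemma family_equivariant (T : cgroup R) X (mu : gaction T X) n
    (chi : 'I_n -> character T) (F : 'I_n -> regfun X) :
  (forall i, homogeneous mu (chi i) (F i)) ->
  equivariant mu (restr_action (char_tuple chi) (natural_action R n)) (family_mor F).
Proof.
move=> hF S g x h h' /=; congr pair; first by rewrite mor_base /= h.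
by apply/funext => i; rewrite hF.
Qed.

Definition monom_fun (X : cfunctor R) n (F : 'I_n -> regfun X) (a : {ffun 'I_n -> nat}) :
    regfun X :=
  rf_prod (index_enum 'I_n) (fun i => rf_exp (F i) (a i)).

Lemma polynomial_expansion n (h : regfun (affine_space R n)) :
  exists l : seq (C * {ffun 'I_n -> nat}), forall S (y : pts (affine_space R n) S),
    h S y = \sum_(q <- l) base y q.1 * monom_fun (@rf_coord R n) q.2 S y.
Proof.
have [t ht] := regfun_term (@coordinates_affine R n) h.
suff [l lE] : exists l : seq (C * {ffun 'I_n -> nat}),
    forall S (y : pts (affine_space R n) S),
    tval (@rf_coord R n) y t =
    \sum_(q <- l) base y q.1 * monom_fun (@rf_coord R n) q.2 S y.
  by exists l => S y; rewrite ht lE.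
elim: t {ht} => [c|i|s [ls IHs] t [lt IHt]|s [ls IHs] t [lt IHt]].
- exists [:: (c, [ffun=> 0%N])] => S y; rewrite big_seq1 /= big1 ?mulr1 // => i _.
  by rewrite ffunE.
- exists [:: (1, [ffun j => (j == i : nat)])] => S y.
  rewrite big_seq1 /= rmorph1 mul1r (bigD1 i) //= ffunE eqxx expr1 big1 ?mulr1 //.
  by move=> j /negPf ji; rewrite ffunE ji.
- by exists (ls ++ lt) => S y; rewrite big_cat -IHs -IHt.
- exists [seq (q.1 * q'.1, [ffun i => (q.2 i + q'.2 i)%N])
            | q : C * {ffun 'I_n -> nat} <- ls, q' : C * {ffun 'I_n -> nat} <- lt] => S y.
  rewrite big_allpairs_dep -[LHS]/(tval _ _ s * tval _ _ t).
  rewrite IHs IHt mulr_suml; apply: eq_bigr => q _.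
  rewrite mulr_sumr; apply: eq_bigr => q' _ /=.
  rewrite rmorphM mulrACA; congr (_ * _); rewrite -big_split.
  by apply: eq_bigr => i _; rewrite /= ffunE exprD.
Qed.

Section Compare.
Variables (T : cgroup R) (r : nat) (phi : ghom T (Gm R r)) (phi' : ghom (Gm R r) T).
Hypothesis phiK : forall S x, phi' S (phi S x) = x.
Hypothesis phiK' : forall S y, phi S (phi' S y) = y.
Variables (n : nat) (chi : 'I_n -> character T).

Definition monom_char (a : {ffun 'I_n -> nat}) : character T :=
  ghom_comp (char_tuple chi) (monomial (\row_i (a i)%:Z)).

Lemma monom_charE a S (g : pts T S) :
  char_val (monom_char a) g = \prod_i char_val (chi i) g ^+ a i.
Proof. by rewrite /char_val /= /Gm_val /= /zprod; apply: eq_bigr => i _; rewrite mxE. Qed.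

Lemma monom_homogeneous X (mu : gaction T X) (F : 'I_n -> regfun X) :
  (forall i, homogeneous mu (chi i) (F i)) ->
  forall c a, homogeneous mu (monom_char a) (rf_mul (rf_cst X c) (monom_fun F a)).
Proof.
move=> hF c a S g x h; rewrite monom_charE /= mor_base /= h mulrCA; congr (_ * _).
by rewrite -big_split; apply: eq_bigr => i _; rewrite /= hF exprMn.
Qed.

Lemma homogeneous_eq X (mu : gaction T X) (m m' : character T) f :
  (forall S (g : pts T S), char_val m g = char_val m' g) ->
  homogeneous mu m f -> homogeneous mu m' f.
Proof. by move=> e hf S g x h; rewrite hf e. Qed.

Lemma weight_monomial X (mu : gaction T X) (F : 'I_n -> regfun X)
    (h : regfun (affine_space R n)) m :
  (forall i, homogeneous mu (chi i) (F i)) ->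
  homogeneous mu m (rf_comp (family_mor F) h) ->
  nonzero (rf_comp (family_mor F) h) ->
  exists a, forall S (g : pts T S), char_val (monom_char a) g = char_val m g.
Proof.
move=> hF hh [S [x hx]]; have [l lE] := polynomial_expansion h.
have hx' : forall S (x : pts X S), rf_comp (family_mor F) h S x =
    \sum_(q <- l) rf_mul (rf_cst X q.1) (monom_fun F q.2) S x.
  by move=> S' x'; rewrite /= lE.
have [q _ qm] := weight_of_sum phiK phiK'
  (fun q => monom_homogeneous hF q.1 q.2) hh hx' hx.
by exists q.2.
Qed.

Lemma weight_of_monomial X (mu : gaction T X) (F : 'I_n -> regfun X) a m :
  (forall i, homogeneous mu (chi i) (F i)) ->
  (forall S (g : pts T S), char_val (monom_char a) g = char_val m g) ->
  nonzero (monom_fun F a) -> weight mu m.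
Proof.
move=> hF am [S [x nz]]; exists (rf_mul (rf_cst X 1) (monom_fun F a)); split.
  by apply: homogeneous_eq am _; apply: monom_homogeneous.
by exists S, x; rewrite /= rmorph1 mul1r.
Qed.

Lemma coord_homogeneous i : homogeneous
  (restr_action (char_tuple chi) (natural_action R n)) (chi i) (@rf_coord R n i).
Proof. by []. Qed.

(** On both sides, m is a weight exactly when it is a product of the chi_i: on
    A^n because functions are sums of monomials, on X because they are
    restrictions of such sums and monomials do not vanish identically. *)
Lemma weight_affine X (mu : gaction T X) (F : 'I_n -> regfun X) m :
  (forall i, homogeneous mu (chi i) (F i)) ->
  closed_immersion (family_mor F) ->
  (forall a, nonzero (monom_fun F a)) ->
  weight (restr_action (char_tuple chi) (natural_action R n)) m <-> weight mu m.
Proof.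
move=> hF cl nz; split=> [[h [hh nh]]|[f [hf nf]]].
  have e S (y : pts (affine_space R n) S) :
      rf_comp (family_mor (@rf_coord R n)) h S y = h S y.
    by case: y.
  have [||a am] := @weight_monomial _ _ (@rf_coord R n) h m coord_homogeneous.
  - by move=> S g x hgx; rewrite !e hh.
  - by case: nh => S [y hy]; exists S, y; rewrite e.
  exact: weight_of_monomial hF am (nz a).
have [h hE] := cl f.
have [||a am] := @weight_monomial _ _ F h m hF.
- by move=> S g x hgx; rewrite /= -!hE hf.
- by case: nf => S [x fx]; exists S, x; rewrite /= -hE.
apply: weight_of_monomial coord_homogeneous am _.
exists C, (idfun : {rmorphism C -> C}, fun=> 1); rewrite /= big1 => [|i _].
  by apply/eqP/oner_neq0.
by rewrite expr1n.
Qed.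

End Compare.
End Weights.

(** * The open orbit of the affine space *)
Section DenseOrbit.
Context {R : realType}.
Local Notation C := R[i].
Variable n : nat.

Definition unit_point : pts (affine_space R n) C :=
  (idfun : {rmorphism C -> C}, fun=> 1).

Lemma orbit_unit_pointP (y : pts (affine_space R n) C) : complex_point y ->
  gorbit (natural_action R n) unit_point y <-> forall i, y.2 i != 0.
Proof.
move=> cy; split=> [[g [h ->]] i|nz].
  rewrite /= mulr1; case: g {h} => [c [[u v] /= uv]]; rewrite /Gm_val /=.
  by apply: contra_eq_neq (uv i) => /= ->; rewrite mul0r eq_sym oner_neq0.
have h i : (y.2, fun i => (y.2 i)^-1).1 i * (y.2, fun i => (y.2 i)^-1).2 i = 1.
  by rewrite /= mulfV.
pose g : pts (Gm R n) C := (y.1, exist _ _ h).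
have gb : base g = base unit_point by apply: rmorphism_eq.
exists g, gb; rewrite [LHS]surjective_pairing; congr pair; first exact: gb.
by apply/funext => i; rewrite /Gm_val /= mulr1.
Qed.

Lemma orbit_open : zariski_open (gorbit (natural_action R n) unit_point).
Proof.
move=> x cx /(orbit_unit_pointP cx) nz.
exists (rf_prod (index_enum 'I_n) (@rf_coord R n)); split=> [|y cy /eqP].
  by apply/eqP/prodf_neq0 => i _; apply: nz.
by move/prodf_neq0 => ny; apply/(orbit_unit_pointP cy) => i; apply: ny.
Qed.

Lemma orbit_dense : zariski_dense (gorbit (natural_action R n) unit_point).
Proof.
move=> V oV [x [cx Vx]]; have [f [fx fV]] := oV x cx Vx.
(* The line from x, at t = 0, to the unit point, at t = 1, as a point with
   values in C[t]; f and the coordinates are nonzero polynomials on it. *)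
pose line : pts (affine_space R n) {poly C} :=
  (polyC : {rmorphism C -> {poly C}}, fun i => (x.2 i)%:P + 'X * (1 - x.2 i)%:P).
pose at_ (t : C) : {rmorphism {poly C} -> C} := horner_eval t.
have atE t (p : {poly C}) : at_ t p = p.[t] by [].
have line_base t : base (pull (at_ t) line) =1 id.
  by move=> c; rewrite /= horner_evalE hornerC.
have line0 : pull (at_ 0) line = x.
  case: x cx @line {Vx fx line_base} => [c v] cx line; congr pair.
    by apply: rmorphism_eq => a; rewrite /= horner_evalE hornerC; rewrite -[RHS]/(c a) cx.
  by apply/funext => i; rewrite /= horner_evalE !hornerE.
pose p := f _ line * \prod_i line.2 i.
have p0 : p != 0.
  rewrite mulf_neq0 //.
    by apply: contra_not_neq fx => f0; rewrite -line0 rf_pull f0 rmorph0.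
  apply/prodf_neq0 => i _; apply/eqP => /(congr1 (at_ 1)).
  by rewrite atE !hornerE /= addrAC subrr add0r rmorph0 => /eqP; rewrite oner_eq0.
have /closed_nonrootP [t] := p0.
rewrite /root hornerM mulf_eq0 negb_or => /andP [ft lt].
exists (pull (at_ t) line); split.
- exact: line_base.
- by apply: fV; [exact: line_base | rewrite rf_pull atE; apply/eqP].
apply/(orbit_unit_pointP (line_base t)) => i.
apply: contraNneq lt => li; rewrite horner_prod (bigD1 i) //= mulf_eq0.
by rewrite -[_.[t]]/(at_ t _) [X in X == 0]li eqxx.
Qed.

End DenseOrbit.

(** * The equivariant embedding *)
Theorem proposition4p1 (R : realType) (X : cfunctor R) (T : cgroup R)
    (mu : gaction T X) (d : nat) (e : 'I_d -> character T)
    (sigma : real_structure X) (tau : real_structure T) :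
  affine_variety X ->
  torus T ->
  lattice_basis e ->
  effective mu ->
  real_group_structure tau ->
  real_action tau sigma mu ->
  exists n : nat, (d <= n)%N /\
    exists (tau' : real_structure (Gm R n))
      (sigma' : real_structure (affine_space R n))
      (j : ghom T (Gm R n)) (i : mor X (affine_space R n)),
    [/\ real_group_structure tau',
        real_mor tau' sigma' (std_embedding R n),
        closed_immersion j /\ real_mor tau tau' j,
        [/\ closed_immersion i, real_mor sigma sigma' i
          & equivariant mu (restr_action j (natural_action R n)) i]
      & (exists2 p : pts (affine_space R n) (complex R),
           [/\ complex_point p,
               zariski_open (gorbit (natural_action R n) p)
             & zariski_dense (gorbit (natural_action R n) p)]
           & exists x : pts X (complex R),
               complex_point x /\ gorbit (natural_action R n) p (i _ x)) /\
        weight_cone (restr_action j (natural_action R n)) e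
          = weight_cone mu e].
Proof.
move=> [A [domA genA [alpha [beta [alphaK betaK]]]]] [r [phi [phi' [phiK phiK']]]].
move=> _ eff tau_group real.
have [k [f [w [le_dk hf nf clf]]]] :=
  homogeneous_generators alphaK betaK phiK phiK' mu d genA.
pose chi i := tmon phi (w i).
pose F := double_fun sigma f; pose psi := double_char tau_group chi.
have hF i : homogeneous mu (psi i) (F i).
  rewrite /F /psi /double_fun /double_char; case: (split i) => a; first exact: hf.
  exact: homogeneous_twist real (hf a).
have nF i : nonzero (F i).
  rewrite /F /double_fun; case: (split i) => a; first exact: nf.
  exact: nonzero_twist.
have clF : closed_immersion (family_mor F) by apply: double_closed_immersion.
pose B : 'M[int]_(k, r) := \matrix_(i, j) w i 0 j.
have rowB i : row i B = w i by apply/rowP => l; rewrite !mxE.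
have [K KB] : exists K : 'M[int]_(r, k), K *m B = 1%:M.
  apply: (effective_generates phiK' (f := f) eff) => [i|].
    by rewrite rowB.
  exact: closed_immersion_inj (coordinates_variety alphaK betaK) clf.
have nz a : nonzero (monom_fun F a).
  by apply: (nonzero_prod alphaK domA) => i; apply: (nonzero_exp alphaK domA).
exists (k + k)%N; split; first exact: leq_trans le_dk (leq_addr _ _).
exists (Gm_twist (@swapK k)), (affine_twist (@swapK k)), (char_tuple psi), (family_mor F).
split.
- exact: Gm_twist_group.
- exact: std_embedding_real.
- split; last exact: tuple_real.
  apply: (tuple_closed_immersion phiK phiK' (iota := lshift k)) KB => i.
  by rewrite rowB /psi /double_char (unsplitK (inl i)).
- split=> //; first exact: family_real.
  exact: family_equivariant.
split.
  exists (unit_point _); first by split=> //; [apply: orbit_open | apply: orbit_dense].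
  have [x [cx nx]] := exists_complex_point alphaK betaK domA genA
    (nonzero_prod alphaK domA (index_enum _) nF).
  exists x; split=> //; apply/orbit_unit_pointP => // i.
  by move/eqP: nx => /prodf_neq0; apply.
congr cone; rewrite predeqE => v; split=> -[m [z [wm ez ->]]]; exists m, z; split=> //.
  exact/(weight_affine phiK phiK' m hF clF nz).
exact/(weight_affine phiK phiK' m hF clF nz).
Qed.
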